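(* Let $G$ be a finite group and assume that there exist two constants $\sigma\ge 1$ and $\eta\ge 2$ such that $m(X,S)\le \sigma\cdot|\pi(S)|^{\eta}$ for every composition factor $S$ of $G$ and for every almost simple group $X$ with $\mathrm{soc}(X)=S$. Then $m(G)\le \sigma\cdot\delta(G)^{\eta}$.
   Context: For a finite group $G$, a generating set $X$ of $G$ is called minimal (or independent) if no proper subset of $X$ generates $G$; $m(G)$ denotes the largest size of a minimal generating set of $G$. For a normal subgroup $N$ of $G$, $m(G,N):=m(G)-m(G/N)$. $\pi(G)$ denotes the set of prime divisors of $|G|$. For a prime $p$, $d_p(G)$ denotes the minimal number of generators of a Sylow $p$-subgroup of $G$, and $\delta(G):=\sum_{p\in\pi(G)}d_p(G)$. A finite group $X$ is almost simple if its socle $\mathrm{soc}(X)$ is a non-abelian simple group $S$, equivalently $S\le X\le\mathrm{Aut}(S)$ up to isomorphism, with $S$ identified with its inner automorphisms (so the hypothesis concerns only the non-abelian composition factors of $G$). The constants $\sigma,\eta$ are real numbers. *)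

(* Defs.v *)
From mathcomp Require Import all_boot all_order all_algebra all_fingroup.
From mathcomp Require Import all_solvable.
From mathcomp Require Import reals exp.

Set Implicit Arguments.
Unset Strict Implicit.
Unset Printing Implicit Defensive.

Import Order.TTheory GroupScope.

Definition min_gen_set (gT : finGroupType) (A X : {set gT}) : bool :=
  minset (fun Y : {set gT} => <<Y>> == A) X.

Definition max_min_gen (gT : finGroupType) (A : {set gT}) : nat :=
  \max_(X : {set gT} | min_gen_set A X) #|X|.

(* Integer-valued, so as to avoid the truncated subtraction of nat. *)
Definition rel_max_min_gen (gT : finGroupType) (A N : {set gT}) : int :=
  ((max_min_gen A)%:Z - (max_min_gen (A / N)%g)%:Z)%R.

Definition socle (gT : finGroupType) (A : {set gT}) : {set gT} :=
  << \bigcup_(M : {group gT} | minnormal M A && (M \subset A)) M >>.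

Canonical socle_group (gT : finGroupType) (A : {set gT}) : {group gT} :=
  Eval hnf in [group of socle A].

Definition almost_simple (gT : finGroupType) (A : {set gT}) : bool :=
  simple (socle A) && ~~ abelian (socle A).

(* mkfactors lists, for each factor of the series s, a canonical section of gT
   isomorphic to it. *)
Definition composition_factor (gT sT : finGroupType)
    (G : {group gT}) (S : {group sT}) : Prop :=
  exists s : seq {group gT},
    comps G s && has (fun F : section gT => S \isog F) (mkfactors G s).

Definition num_primes (gT : finGroupType) (A : {set gT}) : nat :=
  size (primes #|A|).

(* gen_rank, the library's 'm(_), is the least size of a generating set. *)
Definition sylow_rank (gT : finGroupType) (p : nat) (G : {group gT}) : nat :=
  gen_rank (sval (Sylow_exists p G)).

Definition sum_sylow_rank (gT : finGroupType) (G : {group gT}) : nat :=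
  \sum_(p <- primes #|G|) sylow_rank p G.

(* Main.v *)
Require Import Defs.
From mathcomp Require Import all_boot all_order all_algebra all_fingroup.
From mathcomp Require Import all_solvable.
From mathcomp Require Import reals exp lra.

Set Implicit Arguments.
Unset Strict Implicit.
Unset Printing Implicit Defensive.

(* Induct on |G| through a minimal normal subgroup N.  If N is abelian, passing
   from G / N to G raises m by at most 1, and only if N is complemented; then N
   is not contained in the Frattini subgroup of a Sylow subgroup, so delta rises
   as well.

   If N is nonabelian, let M be a simple factor of N and X = N_G(M) / C_G(M), an
   almost simple group with socle M.  Start from a minimal generating set of G
   and a subset generating G modulo N.  At most m(X, M) further generators are
   needed before the subgroup U generated so far meets N in a subgroup
   projecting onto every simple factor of N.  From then on each new generator
   makes U :&: N strictly bigger, hence strictly refines the partition of the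
   set of conjugates of M into the diagonal blocks of U :&: N, and the
   stabiliser in G of the block of M drops strictly, down to N_G(M).  A step of
   this chain whose index is not a power of p increases the number of orbits of
   a Sylow p-subgroup on the set of blocks, and an index > 1 is a power of at
   most one prime; so for two primes p, q dividing |M| the numbers of orbits on
   the conjugates of M add up to at least e + 2, where e is the number of
   remaining generators.  Finally, a form of Tate's theorem shows that
   d_p(G) - d_p(G / N) is at least the number of orbits of a Sylow p-subgroup
   on the conjugates of M, so delta(G) >= delta(G / N) + |pi(M)| + e.
   Superadditivity of x |-> x ^ eta concludes. *)

Import GroupScope.

(** * A form of Tate's theorem *)

Section Tate.

Variables (gT : finGroupType) (p : nat).
Implicit Types G N P Q : {group gT}.

(* Let Q = P :&: N and form E, the fibre product of P / Q' and P N over P N / N.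
   The kernel Z = Q / Q' x 1 of the projection E -> P N has a complement (the
   diagonal) in a Sylow subgroup of E, hence a complement C in E by Gaschutz's
   theorem.  As N is perfect and Z abelian and central in Z x N, C contains
   1 x N, so its projection to P / Q' is a complement to Q / Q'. *)
Lemma perfect_Sylow_quotient_splits G N P :
    N <| G -> p.-Sylow(G) P -> N^`(1) = N ->
  [splits P / (P :&: N)^`(1), over (P :&: N) / (P :&: N)^`(1)].
Proof.
move=> nsNG sylP perfN; set Q := (P :&: N)%G; set Q1 := (Q^`(1))%G.
have sPG := pHall_sub sylP; have pP := pHall_pgroup sylP.
have nNG := normal_norm nsNG.
have nNP : P \subset 'N(N) := subset_trans sPG nNG.
have sQP : Q \subset P := subsetIl P N.
have nsQP : Q <| P by rewrite /normal sQP normsI ?normG.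
have nQ1P : P \subset 'N(Q1) by rewrite gFnorm_trans // normal_norm.
have nQ1Q : Q \subset 'N(Q1) := subset_trans sQP nQ1P.
pose prodT := (coset_of Q1 * gT)%type.
pose i1 := @pairg1 (coset_of Q1) gT; pose i2 := @pair1g (coset_of Q1) gT.
pose f x : prodT := (coset Q1 x, x).
have fM : {in P &, {morph f : x y / x * y}}.
  by move=> x y Px Py; rewrite /f morphM ?(subsetP nQ1P).
pose fm := Morphism fM.
pose D := (fm @* P)%G; pose N2 := (i2 @* N)%G.
have nND : D \subset 'N(N2).
  apply/subsetP=> _ /morphimP[x _ Px ->]; rewrite inE.
  apply/subsetP=> _ /imsetP[_ /morphimP[n _ Nn ->] ->].
  have -> : i2 n ^ fm x = i2 (n ^ x).
    by congr (_, _); rewrite /= mul1g mulVg.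
  by rewrite mem_morphim ?inE // memJ_norm // (subsetP nNP).
pose E := (D <*> N2)%G.
have sDE : D \subset E := joing_subl D N2.
have sN2E : N2 \subset E := joing_subr D N2.
have Df x : x \in P -> f x \in D by move=> Px; apply: (mem_morphim fm).
have N2i n : n \in N -> i2 n \in N2.
  by move=> Nn; rewrite (mem_morphim _ (in_setT _)).
have EP u : u \in E -> exists x n,
  [/\ x \in P, n \in N & u = (coset Q1 x, x * n)].
  rewrite /= norm_joinEl // => /mulsgP[_ _ /morphimP[x _ Px ->]
    /morphimP[n _ Nn ->] ->]; exists x, n; split=> //.
  by congr (_, _); rewrite mulg1.
have inE1 x n : x \in P -> n \in N -> (coset Q1 x, x * n) \in E.
  move=> Px Nn; have -> : (coset Q1 x, x * n) = f x * i2 n.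
    by congr (_, _); rewrite mulg1.
  by rewrite groupM ?(subsetP sDE _ (Df _ _)) ?(subsetP sN2E _ (N2i _ _)).
pose Z := (i1 @* (Q / Q1))%G.
have Z1 u : u \in Z -> u.2 = 1 by case/morphimP=> ? _ _ ->.
have sZE : Z \subset E.
  apply/subsetP=> _ /morphimP[_ _ /morphimP[q _ Qq ->] ->].
  have [Pq Nq] := setIP Qq.
  suff: (coset Q1 q, q * q^-1) \in E by rewrite mulgV.
  by apply: inE1; rewrite ?groupV.
have kerE u : u \in E -> u.2 \in N -> u.1 \in Q / Q1.
  case/EP=> x [n [Px Nn ->]] /=; rewrite groupMr // => Nx.
  by rewrite mem_quotient // inE Px.
have inZ u : u \in E -> u.2 = 1 -> u \in Z.
  move=> Eu u1; have := kerE u Eu; rewrite u1 group1 => /(_ isT).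
  case: u u1 {Eu} => a b /= -> Qa; exact: (mem_morphim _ (in_setT _)).
have nsZE : Z <| E.
  rewrite /normal sZE; apply/subsetP=> u Eu; rewrite inE.
  apply/subsetP=> _ /imsetP[z Zz ->]; apply: inZ.
    by rewrite groupJ // (subsetP sZE).
  by rewrite -[(z ^ u).2]/(z.2 ^ u.2) (Z1 z Zz) conj1g.
have abZ : abelian Z by rewrite morphim_abelian //= (der_abelian 0).
have pZ : p.-group Z.
  by rewrite morphim_pgroup // quotient_pgroup // (pgroupS sQP).
have pD : p.-group D by rewrite morphim_pgroup.
have [S sylS sDS] := Sylow_superset (joing_subl D N2) pD.
have sZS : Z \subset S.
  by rewrite (subset_trans _ (pcore_sub_Hall sylS)) // pcore_max.
have /and3P[sSE pS p'S] := sylS.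
(* The second projection maps [S] onto a p-subgroup of [G] containing [P], so the maximality of [P]
   forces equality. *)
have snd_S : snd @* S = P.
  apply: (sub_pHall sylP); first exact: morphim_pgroup.
    apply/subsetP=> x Px; rewrite -[x]/((f x).2).
    by rewrite (mem_morphim _ (in_setT _)) // (subsetP sDS) // Df.
  apply/subsetP=> _ /morphimP[u _ /(subsetP sSE) /EP[x [n [Px Nn ->]]] ->] /=.
  by rewrite groupM ?(subsetP sPG x) ?(subsetP (normal_sub nsNG) n).
have sndS : snd @* S \subset P by rewrite snd_S.
have splS : [splits S, over Z].
  apply/splitsP; exists D; apply/complP; split.
    apply/trivgP/subsetP=> u /setIP[/Z1 u2 /morphimP[x _ _ def_u]].
    by move: u2; rewrite def_u /= => ->; rewrite inE /f morph1.
  apply/eqP; rewrite eqEsubset mul_subG //=; apply/subsetP=> u Su.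
  have Pu : u.2 \in P by apply: (subsetP sndS);
    apply: (mem_morphim _ (in_setT _)).
  rewrite -(mulgKV (f u.2) u) mem_mulg ?Df //; apply: inZ.
    by rewrite groupM ?groupV ?(subsetP sSE) // (subsetP sDS) // Df.
  by rewrite /= mulgV.
have : [splits E, over Z].
  by rewrite (Gaschutz_split nsZE sZS sSE abZ) // (pnat_coprime pZ p'S).
case/splitsP=> C /complP[tiZC defE].
have sCE : C \subset E by rewrite -defE mulG_subr.
have cZN2 : N2 \subset 'C(Z).
  apply/centsP=> _ /morphimP[n _ _ ->] _ /morphimP[q _ _ ->].
  by congr (_, _); rewrite /= ?mul1g ?mulg1.
have sN2C : N2 \subset C.
  pose T := (Z <*> N2)%G.
  have cTZ : T \subset 'C(Z) by rewrite join_subG [Z \subset _]abZ.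
  have sTE : T \subset E by rewrite join_subG sZE joing_subr.
  have defT : Z \* (C :&: T) = T.
    rewrite cprodE ?(subset_trans (subsetIr _ _)) //.
    by rewrite group_modl ?joing_subl // defE; apply/setIidPr.
  have /cprodP[_ defT1 _] := der_cprod 1 defT.
  have : N2^`(1) \subset T^`(1) by rewrite dergS ?joing_subr.
  rewrite -defT1 (derG1P abZ) mul1g -morphim_der ?subsetT // perfN => sN2.
  by rewrite (subset_trans sN2) // (subset_trans (der_sub _ _)) ?subsetIl.
apply/splitsP; exists (fst @* C)%G; apply/complP; split.
  apply/trivgP/subsetP=> a /setIP[Qa /morphimP[u _ Cu def_a]]; rewrite inE.
  have [x [n [Px Nn def_u]]] := EP _ (subsetP sCE _ Cu).
  have Nu : u.2 \in N.
    move: Qa; rewrite def_a def_u /= => /morphimP[q _ Qq /rcoset_kercosetP].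
    move=> /(_ (subsetP nQ1P _ Px) (subsetP nQ1Q _ Qq)) /rcosetP[y Q1y ->].
    have [_ Nq] := setIP Qq; rewrite !groupM //.
    by have /setIP[] := subsetP (der_sub 1 Q) _ Q1y.
  (* The second coordinate of [u] lies in [N], so [i2 u.2] lies in [C]; dividing by it leaves an
     element of [Z :&: C], which is trivial. *)
  have : u * (i2 u.2)^-1 \in Z :&: C.
    rewrite inE andbC groupM ?groupV // ?(subsetP sN2C) ?N2i //=.
    apply: inZ; last by rewrite /= mulgV.
    by rewrite (subsetP sCE) // groupM ?groupV // (subsetP sN2C) ?N2i.
  rewrite tiZC => /set1gP/(congr1 fst) /=; rewrite invg1 mulg1 -def_a => ->.
  exact/eqP.
apply/eqP; rewrite eqEsubset; apply/andP; split.
  rewrite mul_subG ?quotientS //; apply/subsetP=> _ /morphimP[u _ Cu ->].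
  by have [x [n [Px _ ->]]] := EP _ (subsetP sCE _ Cu); rewrite mem_quotient.
apply/subsetP=> _ /morphimP[x _ Px ->].
have : f x \in E by have := inE1 x 1 Px (group1 N); rewrite mulg1.
rewrite -defE => /mulsgP[z c Zz Cc /(congr1 fst) /= ->].
rewrite mem_mulg //; last by rewrite (mem_morphim _ (in_setT _)).
by apply: kerE; rewrite ?(subsetP sZE) // (Z1 z Zz).
Qed.
End Tate.

(** * Generator ranks of p-groups and of Sylow quotients *)

Lemma exists_quotient_lift (gT : finGroupType) (A : {set gT}) (H : {group gT})
    (B : {set coset_of H}) :
    A \subset 'N(H) -> B \subset A / H ->
  exists C : {set gT}, [/\ C \subset A, C / H = B & #|C| = #|B|].
Proof.
move=> nHA sBA; pose g (b : coset_of H) := odflt 1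
  [pick x in A | coset H x == b].
have gP b : b \in B -> g b \in A /\ coset H (g b) = b.
  move=> /(subsetP sBA) /morphimP[x _ Ax def_b]; rewrite /g.
  by case: pickP => [y /andP[Ay /eqP] | /(_ x)] //=; rewrite Ax def_b eqxx.
have sCA : g @: B \subset A by apply/subsetP=> _ /imsetP[b /gP[? _] ->].
have CB : (g @: B) / H = B.
  rewrite /quotient morphimEsub ?(subset_trans sCA) // -imset_comp.
  apply/setP=> b; apply/imsetP/idP=> [[c Bc ->] | Bb].
    by rewrite /= (gP c Bc).2.
  by exists b; rewrite //= (gP b Bb).2.
exists (g @: B); split=> //; apply/eqP; rewrite eqn_leq leq_imset_card /=.
by rewrite -{1}CB leq_morphim.
Qed.

Section GeneratorRank.

Variables (gT : finGroupType) (p : nat).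
Implicit Types P A : {group gT}.

Lemma grank_Frattini_quotient P : 'm(P / 'Phi(P)) = 'm(P).
Proof.
have nPhi : P \subset 'N('Phi(P)) by rewrite gFnorm.
apply/eqP; rewrite eqn_leq quotient_grank //=.
have [B defB <-] := grank_witness (P / 'Phi(P))%G.
have sBP : B \subset P / 'Phi(P) by rewrite -defB subset_gen.
have [C [sCP CB <-]] := exists_quotient_lift nPhi sBP.
have sCN := subset_trans sCP nPhi.
have genC : 'Phi(P) <*> C = P.
  have defP : P / 'Phi(P) = <<C>> / 'Phi(P) by rewrite quotient_gen // CB defB.
  apply: (etrans _ (quotientGK (Phi_normal P))).
  by rewrite /= defP quotientYK ?gen_subG // joing_idr.
rewrite -[X in 'm(X)](Phi_nongen genC).
exact: grank_min.
Qed.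

Lemma grank_pgroup P : p.-group P -> 'm(P) = logn p #|P : 'Phi(P)|.
Proof.
move=> pP; rewrite -grank_Frattini_quotient.
have abE := Phi_quotient_abelem pP.
rewrite (grank_abelian (abelem_abelian abE)) (rank_abelem abE).
by rewrite card_quotient ?gFnorm.
Qed.

End GeneratorRank.

(** By Burnside's basis theorem the rank is read off the Frattini index. As ['Phi(P / A)] is the
    image of ['Phi(P) <*> A], this index loses the factor |['Phi(P) <*> A] : ['Phi(P)]| > 1. *)
Lemma ltn_grank_quotient (gT : finGroupType) (p : nat) (P A : {group gT}) :
  p.-group P -> A <| P -> ~~ (A \subset 'Phi(P)) -> 'm(P / A) < 'm(P).
Proof.
move=> pP nsAP notAPhi; have nAP := normal_norm nsAP;
  have sAP := normal_sub nsAP.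
rewrite (grank_pgroup pP).
have pPA : p.-group (P / A) := quotient_pgroup A pP.
have sPhiP := Phi_sub P; have nAPhi := subset_trans sPhiP nAP.
have sYP : 'Phi(P) <*> A \subset P by rewrite join_subG sPhiP.
have idx : #|P / A : 'Phi(P / A)| = #|P : 'Phi(P) <*> A|.
  rewrite -(quotient_Phi pP nAP) -(quotientYidr nAPhi).
  by rewrite index_quotient_eq // (subset_trans (subsetIr _ _)) ?joing_subr.
rewrite (grank_pgroup (P := (P / A)%G) pPA) idx.
have pI (B : {group gT}) : p.-nat #|P : B| := pnat_dvd (dvdn_indexg P B) pP.
have [P1 | ntP] := eqVneq P 1%G.
  by case/negP: notAPhi; rewrite (subset_trans sAP) // P1 sub1G.
have [p_pr _ _] := pgroup_pdiv pP ntP.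
rewrite -(ltn_exp2l _ _ (prime_gt1 p_pr)) -!p_part !part_pnat_id //.
rewrite -(Lagrange_index sYP (joing_subl _ _)) ltn_Pmulr // ?indexg_gt1 //.
by rewrite join_subG subxx.
Qed.

Section TateRank.

Variables (gT : finGroupType) (p : nat).
Implicit Types G N P A B : {group gT}.

(** Were Q = [P :&: N] inside ['Phi(P)], a complement to Q / Q' in P / Q' would be all of P / Q', so
    Q = Q'. A p-group with this property is trivial, against [p] dividing |N|. *)
Lemma perfect_Sylow_not_Frattini G N P :
    N <| G -> p.-Sylow(G) P -> N^`(1) = N -> p %| #|N| -> prime p ->
  ~~ (P :&: N \subset 'Phi(P)).
Proof.
move=> nsNG sylP perfN pN p_pr; apply/negP=> sQPhi.
have pP := pHall_pgroup sylP; have sPG := pHall_sub sylP.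
have /splitsP[K /complP[tiK defK]] := perfect_Sylow_quotient_splits nsNG sylP
  perfN.
set Q := (P :&: N)%G in sQPhi tiK defK *.
have nsQP : Q <| P by rewrite /normal subsetIl normsI ?normG //
  (subset_trans sPG) ?normal_norm.
have nQ1P : P \subset 'N(Q^`(1)) by rewrite gFnorm_trans // normal_norm.
have sQPhi1 : Q / Q^`(1) \subset 'Phi(P / Q^`(1)).
  by rewrite -(quotient_Phi pP nQ1P) quotientS.
have defK1 : K :=: P / Q^`(1).
  rewrite -(genGid K) (@Phi_nongen _ (P / Q^`(1))%G K) //=.
  apply/eqP; rewrite eqEsubset join_subG Phi_sub /= -{1}defK mulG_subr /=.
  by rewrite -{1}defK mul_subG ?joing_subr // (subset_trans sQPhi1) ?joing_subl.
have Q1 : Q / Q^`(1) = 1.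
  by rewrite -tiK defK1; apply/esym/setIidPl; rewrite quotientS ?subsetIl.
have sylQ : p.-Sylow(N) Q.
  by rewrite [gval Q]setIC (Sylow_setI_normal nsNG sylP).
have solQ : solvable Q := pgroup_sol (pHall_pgroup sylQ).
have Qtriv : Q :=: 1.
  apply/eqP; case/orP: (orbN (Q :==: 1)) => // ntQ.
  have := sol_der1_proper solQ (subxx _) ntQ.
  case/andP=> _ /negP[]; rewrite -quotient_sub1 ?Q1 //.
  exact: subset_trans (subsetIl _ _) nQ1P.
have := card_Hall sylQ; rewrite Qtriv cards1 => /esym/eqP.
rewrite p_part -(expn0 p) eqn_exp2l ?prime_gt1 // => /eqP logn0.
by have := logn_gt0 p #|N|; rewrite logn0 mem_primes p_pr cardG_gt0 pN.
Qed.

Lemma ltn_Sylow_grank_quotient1 G N P :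
    N <| G -> p.-Sylow(G) P -> N^`(1) = N -> p %| #|N| -> prime p ->
  'm(P / N) < 'm(P).
Proof.
move=> nsNG sylP perfN pN p_pr; have pP := pHall_pgroup sylP.
have nNP : P \subset 'N(N) := subset_trans (pHall_sub sylP) (normal_norm nsNG).
rewrite -(isog_grank (second_isog nNP)) setIC (ltn_grank_quotient pP) //.
  by rewrite /normal subsetIl normsI ?normG.
exact: (perfect_Sylow_not_Frattini nsNG).
Qed.

End TateRank.

(** The previous lemma in [G / A]; this relative form lets a chain of perfect normal subgroups lower
    the rank link by link. *)
Lemma ltn_Sylow_grank_quotient (gT : finGroupType) (p : nat)
    (G A B P : {group gT}) :
    A <| G -> B <| G -> A \subset B -> p.-Sylow(G) P -> B^`(1) = B ->
    p %| #|B : A| -> prime p ->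
  'm(P / B) < 'm(P / A).
Proof.
move=> nsAG nsBG sAB sylP perfB pBA p_pr.
have sPG := pHall_sub sylP; have [sAG nAG] := andP nsAG.
have nAB := subset_trans (normal_sub nsBG) nAG.
have [f injf im_f] := third_isom sAB nsAG nsBG.
have <- : 'm(P / A / (B / A)) = 'm(P / B).
  by rewrite -(im_f P sPG); apply/esym/injm_grank; rewrite ?quotientS.
apply: (@ltn_Sylow_grank_quotient1 _ p (G / A)%G (B / A)%G (P / A)%G) => //.
- exact: quotient_normal.
- by apply: quotient_pHall => //; apply: subset_trans nAG.
- by rewrite /= -quotient_der // perfB.
- by rewrite card_quotient.
Qed.

(** * Double cosets *)

Section DoubleCosets.

Variable gT : finGroupType.
Implicit Types G P Q V W : {group gT}.

(** For subgroups [V] and [Q] of [G], these are the orbits of [Q] on the right cosets of [V] in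
    [G]. *)
Definition double_cosets (V G Q : {set gT}) : {set {set gT}} :=
  [set V :* x * Q | x in G].

Lemma double_cosetsS G Q V W :
  W \subset V -> double_cosets V G Q = mulg (gval V) @: double_cosets W G Q.
Proof.
move=> sWV; rewrite /double_cosets -imset_comp; apply: eq_imset => x /=.
by rewrite -[in RHS]mulgA [RHS]mulgA mulGSid // mulgA.
Qed.

Lemma leq_double_cosets G Q V W :
  W \subset V -> #|double_cosets V G Q| <= #|double_cosets W G Q|.
Proof. by move=> sWV; rewrite (double_cosetsS _ _ sWV) leq_imset_card. Qed.

(** Equal counts make the map from double cosets of [W] to those of [V] injective, so [V] lies in
    [W * Q]; then [V = W * (V :&: Q)], and the index divides |[V :&: Q]|. *)
Lemma pnat_index_double_cosets (p : nat) G Q V W :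
    p.-group Q -> W \subset V -> V \subset G ->
    #|double_cosets V G Q| = #|double_cosets W G Q| ->
  p.-nat #|V : W|.
Proof.
move=> pQ sWV sVG; rewrite (double_cosetsS _ _ sWV) => /eqP/imset_injP injV.
have sVWQ : V \subset W * Q.
  apply/subsetP=> v Vv.
  have -> : W * Q = W :* v * Q.
    have in_dc x : x \in G -> W :* x * Q \in double_cosets W G Q.
      by move=> Gx; apply: imset_f.
    rewrite -[X in X * _ = _](mulg1 W); apply: injV; rewrite ?in_dc //.
      by rewrite (subsetP sVG).
    by rewrite mulg1 !mulgA mulGSid // rcoset_id.
  by apply/mulsgP; exists v 1; rewrite ?rcoset_refl ?group1 ?mulg1.
have defV : W * (V :&: Q) = V.
  by rewrite setIC group_modl //; apply/setIidPr.
have := mul_cardG W (V :&: Q)%G; rewrite defV /= => oV.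
have : #|V : W| %| #|V :&: Q|.
  rewrite -(dvdn_pmul2l (cardG_gt0 W)) Lagrange // oV dvdn_mulr //.
by move/pnat_dvd; apply; apply: pgroupS pQ; apply: subsetIr.
Qed.

(** Neither count drops when [V] shrinks to [W]. If neither grew, the index would be a power of both
    [p] and [q], hence 1. *)
Lemma ltn_double_cosets (p q : nat) G P Q V W :
    p != q -> p.-group P -> q.-group Q -> W \proper V -> V \subset G ->
  #|double_cosets V G P| + #|double_cosets V G Q|
    < #|double_cosets W G P| + #|double_cosets W G Q|.
Proof.
move=> neq_pq pP qQ /andP[sWV not_sVW] sVG; rewrite ltnNge.
apply: contra not_sVW => le_dc; rewrite -indexg_eq1.
have leP := leq_double_cosets G P sWV; have leQ := leq_double_cosets G Q sWV.
have eP : #|double_cosets V G P| = #|double_cosets W G P|.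
  apply/eqP; rewrite eqn_leq leP /= -(leq_add2r #|double_cosets V G Q|).
  by rewrite (leq_trans _ le_dc) // leq_add2l.
have eQ : #|double_cosets V G Q| = #|double_cosets W G Q|.
  apply/eqP; rewrite eqn_leq leQ /= -(leq_add2l #|double_cosets V G P|).
  by rewrite (leq_trans _ le_dc) // leq_add2r.
apply/eqP/(@pnat_1 p); first exact: pnat_index_double_cosets eP.
have := pnat_index_double_cosets qQ sWV sVG eQ.
by apply: sub_in_pnat => r _ /eqnP->; rewrite !inE eq_sym.
Qed.

Lemma double_cosets_gt0 V G Q : 0 < #|double_cosets V G Q|.
Proof. by apply/card_gt0P; exists (V :* 1 * Q); apply: imset_f. Qed.

End DoubleCosets.

(** * The simple factors of a nonabelian minimal normal subgroup *)

Section NonabelianMinimalNormal.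

Variables (gT : finGroupType) (G N M : {group gT}).
Hypotheses (minN : minnormal N G) (sNG : N \subset G) (nabN : ~~ abelian N).
Hypotheses (minM : minnormal M N) (sMN : M \subset N).

Lemma nonabelian_minnormal_normal : N <| G.
Proof. by rewrite /normal sNG; case/mingroupP: minN => /andP[]. Qed.

Let nNG : G \subset 'N(N) := normal_norm nonabelian_minnormal_normal.

Lemma nonabelian_minnormal_max (K : {group gT}) :
  K \subset N -> G \subset 'N(K) -> K :!=: 1 -> K :=: N.
Proof. by case/mingroupP: minN => _ minN1 sKN nKG ntK; apply: minN1;
  rewrite ?ntK. Qed.

Lemma nonabelian_minnormal_cent : 'C_N(N) = 1.
Proof.
apply/eqP; have [//|ntC] := eqVneq 'C_N(N) 1.
case/negP: nabN; rewrite /abelian; apply/setIidPl.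
apply: (@nonabelian_minnormal_max ('C_N(N))%G); rewrite ?subsetIl //.
by rewrite normsI ?norms_cent.
Qed.

Lemma component_neq1 : M :!=: 1.
Proof. by case/mingroupP: minM => /andP[]. Qed.

Lemma component_conj_min g (K : {group gT}) :
  g \in G -> N \subset 'N(K) -> K \subset M :^ g -> K :!=: 1 -> K :=: M :^ g.
Proof.
move=> Gg nKN sKM ntK; case/mingroupP: minM => _ minM1.
apply/(can_inj (conjsgK g^-1)); rewrite conjsgK.
apply: (minM1 (K :^ g^-1)%G); rewrite ?sub_conjgV //=.
rewrite -(conjs1g g^-1) (inj_eq (@conjsg_inj _ _)) ntK normJ.
by rewrite -(normsP nNG g^-1 (groupVr Gg)) conjSg.
Qed.

Lemma component_conj_normal g : g \in G -> M :^ g <| N.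
Proof.
move=> Gg; rewrite -(normsP nNG g Gg) normalJ /normal sMN.
by case/mingroupP: minM => /andP[].
Qed.

(** Distinct minimal normal subgroups of [N] meet trivially, and their commutator lies in the
    intersection. *)
Lemma component_conj_cent g h : g \in G -> h \in G ->
  M :^ g != M :^ h -> M :^ g \subset 'C(M :^ h).
Proof.
move=> Gg Gh neq; have [_ nMg] := andP (component_conj_normal Gg).
have [sMhN nMh] := andP (component_conj_normal Gh).
have [sMgN _] := andP (component_conj_normal Gg).
apply/commG1P; apply: contraNeq neq => ntI.
have sI : [~: M :^ g, M :^ h] \subset M :^ g :&: M :^ h.
  by rewrite commg_subI // subsetI subxx ?(subset_trans sMhN)
    ?(subset_trans sMgN).
have ntI2 : (M :^ g :&: M :^ h)%G :!=: 1.
  by apply: contraNneq ntI => I1; rewrite -subG1 -[1 :> {set gT}]I1.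
have nI : N \subset 'N(M :^ g :&: M :^ h) by rewrite normsI.
apply/eqP; rewrite -(component_conj_min Gg nI _ ntI2) ?subsetIl //.
by rewrite -(component_conj_min Gh nI _ ntI2) ?subsetIr.
Qed.

Lemma gen_component_conj : << \bigcup_(g in G) M :^ g >> = N.
Proof.
apply: nonabelian_minnormal_max.
- by rewrite gen_subG; apply/bigcupsP=> g /component_conj_normal/andP[].
- apply: norms_gen; apply/subsetP=> x Gx; rewrite inE.
  apply/subsetP=> _ /imsetP[y /bigcupP[g Gg Mgy] ->]; apply/bigcupP.
  by exists (g * x); [apply: groupM | rewrite conjsgM memJ_conjg].
apply: contraNneq component_neq1 => gen1; rewrite -subG1 -gen1.
by rewrite sub_gen // (bigcup_max 1) ?group1 // conjsg1.
Qed.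

Lemma component_normal : M <| N.
Proof. by have := component_conj_normal (group1 G); rewrite conjsg1. Qed.

Lemma component_nonabelian : ~~ abelian M.
Proof.
apply: contra nabN => abM; rewrite -gen_component_conj.
rewrite /abelian cent_gen gen_subG; apply/bigcupsP=> g Gg.
apply/centsP=> x Mx y /bigcupP[h Gh My]; move: x Mx y My; apply/centsP.
have [<-|] := eqVneq (M :^ g) (M :^ h); last exact: component_conj_cent.
by rewrite centJ conjSg.
Qed.

Lemma component_centM : M * 'C_N(M) = N.
Proof.
have [_ nMN] := andP component_normal.
apply/eqP; rewrite eqEsubset mul_subG ?subsetIl //=.
rewrite -norm_joinEr ?(subset_trans (subsetIl _ _)) //.
rewrite -{1}gen_component_conj gen_subG; apply/bigcupsP=> g Gg.
have [-> | neq] := eqVneq (M :^ g) M; first exact: joing_subl.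
rewrite (subset_trans _ (joing_subr _ _)) // subsetI.
rewrite (normal_sub (component_conj_normal Gg)) /=.
by have := @component_conj_cent g 1 Gg (group1 G); rewrite conjsg1; apply.
Qed.

(** As [M * 'C_N(M) = N], a subgroup of [M] normalised by [M] is normalised by [N], and minimality
    of [M] in [N] applies. *)
Lemma component_min (K : {group gT}) :
  M \subset 'N(K) -> K \subset M -> K :!=: 1 -> K :=: M.
Proof.
move=> nKM sKM ntK; case/mingroupP: minM => _; apply=> //; rewrite ntK /=.
rewrite -component_centM mul_subG //.
rewrite (subset_trans (subsetIr _ _)) // cents_norm //.
by rewrite centS.
Qed.

Lemma component_simple : simple M.
Proof.
by apply/mingroupP; rewrite component_neq1 normG; split=> // K /andP[ntK nKM]
  sKM;
  apply: component_min.
Qed.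

Lemma component_perfect : M^`(1) = M.
Proof.
apply: (@component_min (M^`(1))%G); rewrite ?der_sub ?gFnorm //.
by apply: contraNneq component_nonabelian => /derG1P.
Qed.

Lemma component_center : 'C_M(M) = 1.
Proof.
apply/eqP; have [//|ntC] := eqVneq 'C_M(M) 1.
case/negP: component_nonabelian; rewrite /abelian; apply/setIidPl.
apply: (@component_min ('C_M(M))%G); rewrite ?subsetIl //.
by rewrite normsI ?norms_cent ?normG.
Qed.

(** If [g] normalised ['C_N(M)] but moved [M], then [M :^ g] would centralise [M], hence lie in
    ['C_N(M) = 'C_N(M :^ g)] and be abelian. *)
Lemma norm_component_subcent : 'N_G('C_N(M)) = 'N_G(M).
Proof.
apply/setP=> g; rewrite !in_setI; apply: andb_id2l => Gg; apply/idP/idP =>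
  [nCg | nMg].
  have eC : 'C_N(M :^ g) = 'C_N(M).
    by rewrite centJ -{1}(normsP nNG g Gg) -conjIg (normP nCg).
  have [/eqP eM | neq] := eqVneq (M :^ g) M; first exact/normP/eqP.
  have : M :^ g \subset 'C_N(M :^ g).
    rewrite eC subsetI (normal_sub (component_conj_normal Gg)) /=.
    by have := @component_conj_cent g 1 Gg (group1 G); rewrite conjsg1; apply.
  by rewrite subsetI centJ conjSg => /andP[_ /negPn];
    rewrite component_nonabelian.
by apply/normP; rewrite conjIg -centJ (normP nMg) (normsP nNG g Gg).
Qed.

(** With [E] a set of double cosets of ['N_G(M)] and [Q], this is the product of the conjugates of
    [M] in the selected [Q]-orbits. *)
Definition conj_join (E : {set {set gT}}) := << \bigcup_(g in cover E) M :^ g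
  >>.

Canonical conj_join_group (E : {set {set gT}}) : {group gT} :=
  Eval hnf in [group of conj_join E].

Lemma double_coset_eq (V Q : {group gT}) x g :
  g \in V :* x * Q -> V :* g * Q = V :* x * Q.
Proof.
case/mulsgP=> _ q /rcosetP[n Nn ->] Qq ->.
by rewrite rcosetM -mulgA lcoset_id // rcosetM rcoset_id.
Qed.

(* The double cosets of 'N_G(M) and Q correspond to the orbits of Q on the
   conjugates of M.  Adding the orbits one at a time gives a chain of perfect
   normal subgroups of N Q, and each step lowers the rank of the image of Q. *)
Lemma Sylow_grank_components (p : nat) (Q : {group gT}) :
    prime p -> p.-Sylow(G) Q -> p %| #|M| ->
  'm(Q / N) + #|double_cosets 'N_G(M) G Q| <= 'm(Q).
Proof.
move=> p_pr sylQ pM; set dc := double_cosets _ _ _.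
have sQG := pHall_sub sylQ; have nNQ := subset_trans sQG nNG.
have sNQG : N <*> Q \subset G by rewrite join_subG sNG.
(* The joins below are normal in [N <*> Q] but need not be normal in [G], so the rank drop is
   measured in [N <*> Q]. *)
have sylQ1 := pHall_subl (joing_subr N Q) sNQG sylQ.
have coverP (E : {set {set gT}}) g : E \subset dc -> g \in cover E ->
    g \in G /\ 'N_G(M) :* g * Q \in E.
  move=> /subsetP sEdc /bigcupP[D ED Dg].
  have /imsetP[x Gx def_D] := sEdc _ ED; rewrite def_D in Dg ED.
  rewrite (double_coset_eq Dg); split=> //; apply: subsetP Dg.
  by rewrite !mul_subG ?subsetIl ?sub1set.
have cover_stable (E : {set {set gT}}) g q : E \subset dc ->
    g \in cover E -> q \in Q -> g * q \in cover E.
  move=> sEdc Eg Qq; have [_ Eg1] := coverP E g sEdc Eg.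
  by apply/bigcupP; exists ('N_G(M) :* g * Q); rewrite // mem_mulg ?rcoset_refl.
have sMJ (E : {set {set gT}}) g : g \in cover E -> M :^ g \subset conj_join E.
  by move=> Eg; rewrite sub_gen // (bigcup_max g).
have joinN (E : {set {set gT}}) : E \subset dc -> conj_join E <| N <*> Q.
  move=> sEdc; apply/andP; split.
    rewrite (subset_trans _ (joing_subl _ _)) // gen_subG; apply/bigcupsP=> g.
    by case/(coverP E g sEdc)=> /component_conj_normal/andP[].
  rewrite join_subG; apply/andP; split; apply: norms_gen; last first.
    apply/subsetP=> q Qq; rewrite inE; apply/subsetP=> _ /imsetP[y My ->].
    case/bigcupP: My => g Eg My; apply/bigcupP; exists (g * q).
      exact: cover_stable.
    by rewrite conjsgM memJ_conjg.
  apply: norms_bigcup; apply/bigcapsP=> g /(coverP E g sEdc)[Gg _].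
  exact: normal_norm (component_conj_normal Gg).
have perfJ (E : {set {set gT}}) : (conj_join E)^`(1) = conj_join E.
  apply/eqP; rewrite eqEsubset der_sub /= {1}/conj_join gen_subG.
  apply/bigcupsP=> g Eg; rewrite -{1}component_perfect -derJ dergS //.
  exact: sMJ.
suffices main (E : {set {set gT}}) :
    E \subset dc -> 'm(Q / conj_join E) + #|E| <= 'm(Q).
  have <- : conj_join dc = N; last exact: main.
  rewrite -gen_component_conj /conj_join; congr << _ >>; apply: eq_bigl => g.
  apply/idP/idP=> [/coverP-/(_ (subxx _))[] // | Gg].
  apply/bigcupP; exists ('N_G(M) :* g * Q); first exact: imset_f.
  by rewrite -[g in X in X \in _]mulg1 mem_mulg ?rcoset_refl.
elim: {E}_.+1 {-2}E (ltnSn #|E|) => // n IHn E; rewrite ltnS => leEn sEdc.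
have [-> | [D ED]] := set_0Vmem E; first rewrite cards0 addn0 quotient_grank //.
  by rewrite /= /conj_join /cover !big_set0 gen0 norms1.
pose F := E :\ D; have sFE : F \subset E := subsetDl E _.
have sFdc := subset_trans sFE sEdc.
have cE : #|E| = #|F|.+1 by rewrite (cardsD1 D) ED.
rewrite cE addnS -addSn (leq_trans _ (IHn F _ sFdc)) -?cE // leq_add2r.
have sJ : conj_join F \subset conj_join E.
  rewrite gen_subG; apply/bigcupsP=> g /bigcupP[B FB Bg].
  by apply: sMJ; apply/bigcupP; exists B; rewrite ?(subsetP sFE).
apply: (ltn_Sylow_grank_quotient (joinN F sFdc) (joinN E sEdc)) sylQ1 (perfJ E)
  _ _ => //.
have /imsetP[x Gx defD] := subsetP sEdc D ED.
have Ex : x \in cover E.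
  by apply/bigcupP; exists D; rewrite // defD -[x in X in X \in _]mulg1 mem_mulg
    ?rcoset_refl.
(* A [g] in [cover F] with [M :^ g = M :^ x] would lie in the removed double coset [D]. So the two
   groups commute and meet trivially, and |M| divides the index of [conj_join F] in
   [conj_join E]. *)
have cFM : conj_join F \subset 'C(M :^ x).
  rewrite gen_subG; apply/bigcupsP=> g Fg; have [Gg Fg1] := coverP F g sFdc Fg.
  apply: component_conj_cent => //; apply: contraTneq Fg1 => eqM.
  have -> : 'N_G(M) :* g * Q = D; last by rewrite setD11.
  rewrite defD; apply: double_coset_eq.
  rewrite -[g in X in X \in _]mulg1 mem_mulg // mem_rcoset inE groupM
    ?groupV //=.
  by apply/normP; rewrite conjsgM eqM conjsgK.
have tiMF : conj_join F :&: M :^ x = 1.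
  have C1 : M :^ x :&: 'C(M :^ x) = 1.
    by rewrite centJ -conjIg component_center conjs1g.
  by apply/trivgP; rewrite /= -C1 setIC setIS.
have sFM : conj_join F <*> M :^ x \subset conj_join E by rewrite join_subG sJ
  sMJ.
have oFM : #|conj_join F <*> M :^ x| = (#|conj_join F| * #|M|)%N.
  by rewrite norm_joinEr 1?centsC ?TI_cardMg ?cardJg // cents_norm // centsC.
rewrite -(dvdn_pmul2l (cardG_gt0 (conj_join_group F))) Lagrange //=.
by rewrite (dvdn_trans _ (cardSg sFM)) //= oFM dvdn_mul.
Qed.

End NonabelianMinimalNormal.

(** * Subdirect subgroups of a nonabelian minimal normal subgroup *)

Section IntersectionOfMaximalNormal.

Variables (gT : finGroupType) (L : {group gT}).
Implicit Types (K : {group gT}) (s : seq {group gT}).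

Definition nonabelian_maxnormal (K : {group gT}) : bool :=
  maxnormal K L L && ~~ (L^`(1) \subset K).

Definition capG s : {group gT} := foldr (fun K I => (K :&: I)%G) L s.

Lemma capG_normal s : all nonabelian_maxnormal s -> capG s <| L.
Proof.
elim: s => [|K s IHs] /=; first by rewrite normal_refl.
case/andP=> /andP[maxK _] /IHs; rewrite /normal => /andP[sI nI].
have [_ nK] := andP (maxnormal_normal maxK).
by rewrite (subset_trans (subsetIr _ _) sI) normsI.
Qed.

(** Otherwise maximality of [K] puts [K1 :&: capG s] inside [K]. Both [K1] and [capG s] map onto
    [L / K], and their commutator lies in their intersection, so [L / K] would be abelian. *)
Lemma mulg_capG_maxnormal s K :
    all nonabelian_maxnormal s -> nonabelian_maxnormal K -> K \notin s ->
  capG s * K = L.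
Proof.
elim: s K => [|K1 s IHs] K /=.
  move=> _ /andP[maxK _] _; rewrite mulGSid //.
  exact: maxnormal_sub maxK.
case/andP=> maxK1 max_s maxK; rewrite inE negb_or => /andP[neqK notKs].
have nK1 : K1 <| L by apply: maxnormal_normal; case/andP: maxK1.
have nK : K <| L by apply: maxnormal_normal; case/andP: maxK.
have [sK1L nK1L] := andP nK1; have [sKL nKL] := andP nK.
have defL := IHs K max_s maxK notKs.
have [sIL nIL] := andP (capG_normal max_s).
case/andP: maxK => maxK not_sL'K.
have defL1 : K1 * K = L.
  apply: maxnormalM => //; first by case/andP: maxK1.
  by apply/eqP; rewrite eq_sym.
set I := capG s in defL sIL nIL *.
have sKIL : (K1 :&: I)%G <*> K \subset L.
  by rewrite join_subG sKL (subset_trans (subsetIr _ _)).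
have nKIL : L \subset 'N((K1 :&: I)%G <*> K) by rewrite normsY // normsI.
rewrite -norm_joinEl; last by rewrite (subset_trans _ nKL) //
  (subset_trans (subsetIr _ _)).
apply: contraNeq not_sL'K => ltIKL.
have /maxgroupP[_ maxK2] := maxK.
have defK : (K1 :&: I)%G <*> K = K.
  by apply: maxK2; rewrite ?joing_subr // properEneq ltIKL sKIL.
rewrite -quotient_cents2 // -{1}defL1 -defL !quotientMidr.
rewrite quotient_cents2 ?(subset_trans sK1L) ?(subset_trans sIL) //.
apply: (@subset_trans _ _ ((K1 :&: I)%G <*> K)); last by rewrite defK.
rewrite (subset_trans _ (joing_subl _ _)) //.
by rewrite commg_subI // subsetI subxx ?(subset_trans sK1L) ?(subset_trans sIL).
Qed.

Lemma index_capG s c :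
    uniq s -> all nonabelian_maxnormal s -> {in s, forall K, #|L : K| = c} ->
  #|L : capG s| = (c ^ size s)%N.
Proof.
elim: s => [|K s IHs] /=; first by rewrite indexgg.
case/andP=> notKs uniq_s /andP[maxK max_s] idx.
have defL := mulg_capG_maxnormal max_s maxK notKs.
have [sIL nIL] := andP (capG_normal max_s).
have sKL : K \subset L by case/andP: maxK => /maxnormal_sub.
rewrite expnS; have <- : #|L : capG s| = (c ^ size s)%N.
  by apply: IHs => // H sH; apply: idx; rewrite inE sH orbT.
rewrite -(idx K (mem_head _ _)).
rewrite -(Lagrange_index sKL (subsetIl K (capG s))); congr (_ * _)%N.
have e := mul_cardG (capG s) K.
rewrite defL setIC -(Lagrange (subsetIl K (capG s))) -[#|L|](Lagrange sIL) in e.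
apply/eqP; rewrite -(@eqn_pmul2l (#|capG s| * #|K :&: capG s|)).
  by rewrite -mulnA e mulnAC.
by rewrite muln_gt0 !cardG_gt0.
Qed.

End IntersectionOfMaximalNormal.

Section SubdirectSubgroups.

Variables (gT : finGroupType) (G N M : {group gT}).
Hypotheses (minN : minnormal N G) (sNG : N \subset G) (nabN : ~~ abelian N).
Hypotheses (minM : minnormal M N) (sMN : M \subset N).

Let nsNG : N <| G := nonabelian_minnormal_normal minN sNG.
Let nNG : G \subset 'N(N) := normal_norm nsNG.

Lemma component_conj_minnormal g : g \in G -> minnormal (M :^ g) N.
Proof.
move=> Gg; apply/mingroupP; split.
  have [_ ->] := andP (component_conj_normal minN sNG minM sMN Gg).
  by rewrite -(conjs1g g) (inj_eq (@conjsg_inj _ g)) (component_neq1 minM).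
by move=> K /andP[ntK nKN] sK; apply: (component_conj_min minN sNG minM Gg).
Qed.

(** Both [L] and [M] map onto [N / 'C_N(M)], and [M] does so isomorphically because its centre is
    trivial. *)
Lemma component_proj_isog (L : {group gT}) :
  L \subset N -> L * 'C_N(M) = N -> L / 'C_L(M) \isog M.
Proof.
move=> sLN defN.
have nCN : N \subset 'N('C_N(M)).
  rewrite normsI ?normG // norms_cent //.
  by case/andP: (component_normal minN sNG minM sMN).
have nCL := subset_trans sLN nCN; have nCM := subset_trans sMN nCN.
have -> : 'C_L(M) = 'C_N(M) :&: L by rewrite setIAC (setIidPr sLN).
apply: isog_trans (second_isog nCL) _.
have eLM : L / 'C_N(M)%G = M / 'C_N(M)%G.
  by rewrite -(quotientMidr _ L) defN -(quotientMidr _ M)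
    (component_centM minN).
suff: M / 'C_N(M)%G \isog M by rewrite -eLM.
apply: isog_symr; apply: isog_trans (second_isog nCM).
have -> : 'C_N(M) :&: M = 1.
  rewrite -setIA [_ :&: M]setIC setIA (setIidPr sMN).
  exact: component_center minN sNG nabN minM sMN.
exact: quotient1_isog.
Qed.

Lemma component_proj_maxnormal (L : {group gT}) :
    L \subset N -> L * 'C_N(M) = N ->
  nonabelian_maxnormal L 'C_L(M)%G /\ #|L : 'C_L(M)| = #|M|.
Proof.
move=> sLN defN; have isoM := component_proj_isog sLN defN.
have nsC : 'C_L(M) <| L.
  rewrite /normal subsetIl normsI ?normG // norms_cent //.
  by rewrite (subset_trans sLN) //;
    case/andP: (component_normal minN sNG minM sMN).
split; last by rewrite -card_quotient ?(card_isog isoM) // normal_norm.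
rewrite /nonabelian_maxnormal -quotient_simple // (isog_simple isoM).
rewrite (component_simple minN sNG minM sMN) /=.
apply: contra (component_nonabelian minN sNG nabN minM sMN) => sL'C.
by rewrite -(isog_abelian isoM) /= sub_der1_abelian.
Qed.

End SubdirectSubgroups.

Section SubdirectOrder.

Variables (gT : finGroupType) (G N M : {group gT}).
Hypotheses (minN : minnormal N G) (sNG : N \subset G) (nabN : ~~ abelian N).
Hypotheses (minM : minnormal M N) (sMN : M \subset N).

Let nsNG : N <| G := nonabelian_minnormal_normal minN sNG.
Let nNG : G \subset 'N(N) := normal_norm nsNG.

(** As [N] normalises [M], the conjugates of [M] under [U] are all those under [G]; they generate
    [N], which has trivial centre. *)
Lemma bigcap_component_cent (U : {group gT}) x :
    N * U = G -> x \in N -> (forall u, u \in U -> x \in 'C(M :^ u)) -> x = 1.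
Proof.
move=> defG Nx cx; apply/set1gP;
  rewrite -(nonabelian_minnormal_cent minN sNG nabN).
rewrite inE Nx -(gen_component_conj minN sNG minM sMN) cent_gen.
apply/centP=> y /bigcupP[g]; rewrite -defG => /mulsgP[n u Nn Uu ->].
rewrite conjsgM (normsP _ n Nn); last first.
  by case/andP: (component_normal minN sNG minM sMN).
by move=> My; apply: (centP (cx u Uu)).
Qed.

(* The exponent is the number of conjugates of the kernel 'C_L(M) of the
   projection L -> M, i.e. the number of simple factors of L. *)
Lemma subdirect_order (U L : {group gT}) :
    N * U = G -> L \subset N -> U \subset 'N(L) -> L * 'C_N(M) = N ->
  #|L| = (#|M| ^ #|U : 'N_U('C_L(M))|)%N.
Proof.
move=> defG sLN nLU defN.
have sUG : U \subset G by rewrite -defG mulG_subr.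
pose O := orbit 'JG U 'C_L(M)%G.
have oO : #|O| = #|U : 'N_U('C_L(M))|.
  by rewrite card_orbit ?subsetT // astab1JG.
have OP K : K \in O -> nonabelian_maxnormal L K /\ #|L : K| = #|M|.
  case/orbitP=> u Uu <-; have Gu := subsetP sUG u Uu.
  have sMuN : M :^ u \subset N.
    by case/andP: (component_conj_normal minN sNG minM sMN Gu).
  have defCu : 'C_L(M) :^ u = 'C_L(M :^ u).
    by rewrite conjIg (normsP nLU) // centJ.
  have defNu : L * 'C_N(M :^ u) = N.
    have := congr1 (conjugate^~ u) defN.
    by rewrite /= conjsMg conjIg -centJ (normsP nLU) // (normsP nNG).
  have [] := component_proj_maxnormal minN sNG nabN
    (component_conj_minnormal minN sNG minM sMN Gu) sMuN sLN defNu.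
  rewrite cardJg /= => max_u <-; rewrite defCu; split=> //.
  by congr (is_true (nonabelian_maxnormal _ _)): max_u; apply: val_inj.
have max_O : all (nonabelian_maxnormal L) (enum O).
  by apply/allP=> K; rewrite mem_enum => /OP[].
have idx_O : {in enum O, forall K : {group gT}, #|L : K| = #|M|}.
  by move=> K; rewrite mem_enum => /OP[].
(* The conjugate kernels intersect trivially, since a common element centralises every [U]-conjugate
   of [M]; the index formula then gives |L|. *)
have := index_capG (enum_uniq O) max_O idx_O.
rewrite -cardE oO => <-; suff -> : capG L (enum O) = 1%G by rewrite indexg1.
apply: val_inj; apply/trivgP/subsetP=> x /= Cx; apply/set1gP.
have xP s : x \in capG L s -> x \in L /\ forall K, K \in s -> x \in gval K.
  elim: s => [|K s IHs] /=; first by move=> Lx; split.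
  case/setIP=> Kx /IHs[Lx sx]; split=> // H; rewrite inE => /predU1P[-> // |].
  exact: sx.
have [Lx CxO] := xP _ Cx.
apply: (bigcap_component_cent defG); first exact: (subsetP sLN).
move=> u Uu; have : ('C_L(M) :^ u)%G \in enum O.
  by rewrite mem_enum; apply/orbitP; exists u.
by move/CxO; rewrite /= conjIg -centJ => /setIP[].
Qed.

(** The stabiliser for [L2] lies in that for [L1]; since its index determines the order by
    [subdirect_order], equality would force |L1| = |L2|. *)
Lemma subdirect_stab_proper (U L1 L2 : {group gT}) :
    N * U = G -> L1 \subset N -> L2 \subset N ->
    U \subset 'N(L1) -> U \subset 'N(L2) ->
    L1 * 'C_N(M) = N -> L2 * 'C_N(M) = N -> L1 \proper L2 ->
  'N_U('C_L2(M)) \proper 'N_U('C_L1(M)).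
Proof.
move=> defG sL1 sL2 nL1 nL2 def1 def2 ltL.
have sN : 'N_U('C_L2(M)) \subset 'N_U('C_L1(M)).
  have -> : 'C_L1(M) = L1 :&: 'C_L2(M).
    by rewrite setIA (setIidPl (proper_sub ltL)).
  rewrite subsetI subsetIl normsI ?subsetIr //.
  exact: subset_trans (subsetIl _ _) nL1.
rewrite properEneq sN andbT; apply: contraTneq ltL => eqN.
rewrite properEcard negb_and orbC -leqNgt.
by rewrite (subdirect_order defG sL1) // (subdirect_order defG sL2) // eqN
  leqnn.
Qed.

End SubdirectOrder.

(** * Minimal generating sets *)

Section MinimalGeneratingSets.

Variable gT : finGroupType.
Implicit Types (G H X S A : {group gT}) (Y Z B : {set gT}).

Lemma min_gen_setP G Z :
  reflect (<<Z>> = G /\ forall Y, Y \subset Z -> <<Y>> = G -> Y = Z)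
          (min_gen_set G Z).
Proof.
apply: (iffP minsetP) => [[/eqP genZ minZ] | [genZ minZ]].
  by split=> // Y sYZ genY; apply: minZ => //; apply/eqP.
by split=> [|Y /eqP genY sYZ]; [apply/eqP | apply: minZ].
Qed.

Lemma leq_max_min_gen G Z : min_gen_set G Z -> #|Z| <= max_min_gen G.
Proof. by move=> minZ; apply: (bigmax_sup Z). Qed.

Lemma max_min_gen_witness G :
  exists2 Z : {set gT}, min_gen_set G Z & #|Z| = max_min_gen G.
Proof.
have [Z minZ _] : {Z | min_gen_set G Z & Z \subset G}.
  by apply: minset_exists; rewrite genGid.
have [|Y minY eqY] := @eq_bigmax_cond _ (min_gen_set G)
  (fun Y : {set gT} => #|Y|).
  by apply/card_gt0P; exists Z.
by exists Y; rewrite -?eqY.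
Qed.

Lemma min_gen_set_notin G Z B y :
  min_gen_set G Z -> B \subset Z -> y \in Z -> y \notin B -> y \notin << B >>.
Proof.
case/min_gen_setP=> genZ minZ sBZ Zy notBy; apply/negP=> By.
suff defZ : Z :\ y = Z by have := setD11 y Z; rewrite defZ Zy.
apply: minZ; first exact: subsetDl.
apply/eqP; rewrite eqEsubset -{1 2}genZ genS ?subsetDl //= gen_subG.
apply/subsetP=> z Zz; have [-> | neq_zy] := eqVneq z y; last first.
  by rewrite mem_gen // in_setD1 neq_zy.
by apply: subsetP By; rewrite genS // subsetD1 sBZ.
Qed.

End MinimalGeneratingSets.

(* A minimal generating set of X / S of maximal size lifts to a subset B of A;
   a minimal V0 among the subsets of (A :&: S) and of the T j that generate X
   together with B must contain an element specific to each T j. *)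
Lemma leq_max_min_gen_nested (gT : finGroupType) (I : finType) (J : {set I})
    (T : I -> {set gT}) (X S A : {group gT}) :
    S <| X -> A \subset X -> X \subset S * A ->
    {in J, forall j, T j \subset S} ->
    << A :|: \bigcup_(j in J) T j >> = X ->
    {in J, forall j, << A :|: \bigcup_(i in J :\ j) T i >> != X} ->
  #|J| + max_min_gen (X / S) <= max_min_gen X.
Proof.
move=> /andP[sSX nSX] sAX defX sTS genX irrX.
have nSA := subset_trans sAX nSX.
have eAX : A / S = X / S.
  by apply/eqP; rewrite eqEsubset quotientS //= -(quotientMidl _ A) quotientS.
have [W minW oW] := max_min_gen_witness (X / S)%G.
have [genW {}minW] := min_gen_setP _ _ minW.
have sWA : W \subset A / S by rewrite eAX /= -genW subset_gen.
have [B [sBA defW oB]] := exists_quotient_lift nSA sWA.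
have nSB := subset_trans sBA nSA.
pose V := (A :&: S) :|: \bigcup_(j in J) T j.
have sVS : V \subset S by rewrite subUset subsetIr; apply/bigcupsP.
(* [B] generates [A] modulo [S], so what is missing from [A] lies in [A :&: S]; this is why [V]
   includes that set. *)
have sAB : A \subset << B >> * (S :&: A).
  rewrite group_modl ?gen_subG // subsetI subxx andbT.
  have nSgB : << B >> \subset 'N(S) by rewrite gen_subG.
  rewrite (normC nSgB) -quotientK // -sub_quotient_pre //.
  by rewrite quotient_gen // defW genW /= -eAX.
have genV : << B :|: V >> = X.
  apply/eqP; rewrite eqEsubset gen_subG [B :|: V \subset _]subUset
    (subset_trans sBA) //=.
  rewrite (subset_trans sVS) //= -{1}genX gen_subG subUset.
  rewrite (subset_trans sAB) /=; last first.
    rewrite mul_subG ?genS ?subsetUl // setIC sub_gen //.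
    by rewrite (subset_trans _ (subsetUr _ _)) // subsetUl.
  by rewrite sub_gen // setUA subsetUr.
have [V0 /minsetP[/eqP genV0 minV0] sV0V] :
    {V0 : {set gT} | minset (fun Y => << B :|: Y >> == X) V0 & V0 \subset V}.
  by apply: minset_exists; rewrite genV.
have sV0S := subset_trans sV0V sVS.
have disBV0 : V0 :\: B = V0.
  apply: minV0; last exact: subsetDl.
  by apply/eqP; rewrite -genV0; congr << _ >>; apply/setP=> x; rewrite !inE;
    case: (x \in B).
(* The part of [Y] in [B] still generates modulo [S], so its image is [W] and counting makes it all
   of [B]; minimality of [V0] does the rest. *)
have minBV0 : min_gen_set X (B :|: V0).
  apply/min_gen_setP; split=> // Y sYBV genY.
  have sYX : Y \subset X by rewrite -genY subset_gen.
  have defY : Y = (Y :&: B) :|: (Y :&: V0) by rewrite -setIUr;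
    apply/esym/setIidPl.
  have YW : (Y :&: B) / S = W.
    apply: minW; first by rewrite -defW quotientS ?subsetIr.
    have nSY := subset_trans sYX nSX.
    rewrite -quotient_gen ?(subset_trans (subsetIl _ _)) //=.
    apply/eqP; rewrite eqEsubset quotientS /=; last first.
      by rewrite gen_subG (subset_trans (subsetIl _ _)).
    rewrite -{1}genY {1}defY quotient_gen; last by rewrite -defY.
    rewrite gen_subG quotientU subUset quotientS ?subset_gen //=.
    rewrite (subset_trans (quotientS S (subset_trans (subsetIr Y V0) sV0S))) //.
    by rewrite trivg_quotient sub1G.
  have YB : Y :&: B = B.
    apply/eqP; rewrite eqEcard subsetIr /= oB -YW leq_morphim //.
  have YV0 : Y :&: V0 = V0.
    by apply: minV0; [rewrite -{1}YB -defY genY | apply: subsetIr].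
  by rewrite defY YB YV0.
apply: leq_trans (leq_max_min_gen minBV0).
rewrite cardsU -[in X in _ - X]disBV0 setIDA.
have -> : B :&: V0 :\: B = set0 by apply/setP=> x; rewrite !inE;
  case: (x \in B).
rewrite cards0 subn0 oB oW addnC leq_add2l.
pose F j := A :|: \bigcup_(i in J :\ j) T i.
(* Without an element of [V0] specific to [T j], both [B] and [V0] would lie in [F j], which does
   not generate [X]. *)
have ex_g j : j \in J -> exists v, [&& v \in V0, v \in T j & v \notin F j].
  move=> Jj; apply/existsP; apply: contraR (irrX j Jj).
  rewrite negb_exists => /forallP noV; rewrite eqEsubset; apply/andP; split.
    rewrite gen_subG subUset sAX; apply/bigcupsP=> i /setD1P[_ Ji].
    exact: subset_trans (sTS i Ji) sSX.
  rewrite -{1}genV0 genS // subUset (subset_trans sBA) ?subsetUl //=.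
  apply/subsetP=> v V0v; have := noV v; rewrite V0v /= -/(F j).
  have := subsetP sV0V v V0v; case/setUP=> [/setIP[Av _] | /bigcupP[i Ji Tv]].
    by rewrite inE Av.
  have [<- | neq_ij] := eqVneq i j; first by rewrite Tv negbK.
  by move=> _; apply/setUP; right; apply/bigcupP; exists i;
    rewrite // in_setD1 neq_ij.
pose g j := odflt 1 [pick v | [&& v \in V0, v \in T j & v \notin F j]].
have gP j : j \in J -> [&& g j \in V0, g j \in T j & g j \notin F j].
  move/ex_g=> [v vP]; rewrite /g; case: pickP => [//|/(_ v)]; by rewrite vP.
have inj_g : {in J &, injective g}.
  move=> i j Ji Jj eq_g; apply/eqP; apply: contraT => neq_ij.
  have /and3P[_ _ /negP[]] := gP j Jj; have /and3P[_ Ti _] := gP i Ji.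
  rewrite -eq_g; apply/setUP; right; apply/bigcupP; exists i => //.
  by rewrite in_setD1 neq_ij.
rewrite -(card_in_imset inj_g) subset_leq_card //.
by apply/subsetP=> _ /imsetP[j /gP/and3P[V0g _ _] ->].
Qed.

Lemma nonabelian_simple_not_pgroup (gT : finGroupType) (p : nat)
  (S : {group gT}) :
  simple S -> ~~ abelian S -> ~~ p.-group S.
Proof.
case/simpleP=> ntS simS nabS; apply: contra nabS => pS.
have solS := pgroup_sol pS; have ltS := sol_der1_proper solS (subxx S) ntS.
have [|/= S'1|defS'] := simS (S^`(1))%G; first exact: der_normal.
  exact/derG1P.
by rewrite defS' properxx in ltS.
Qed.

(** By the Frattini argument [S] and the normaliser of a Sylow subgroup [P] of [S] generate [X].
    That normaliser is proper, as [P] is not normal in [S], so [leq_max_min_gen_nested] applies with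
    the single set [S]. *)
Lemma ltn_max_min_gen_simple (gT : finGroupType) (X S : {group gT}) :
    S <| X -> simple S -> ~~ abelian S ->
  max_min_gen (X / S) < max_min_gen X.
Proof.
move=> nsSX simS nabS; have [sSX nSX] := andP nsSX.
have [ntS simS1] := simpleP _ simS.
pose p := pdiv #|S|; have [P sylP] := Sylow_exists p S.
have p_pr : prime p by rewrite pdiv_prime // cardG_gt1.
have defX := Frattini_arg nsSX sylP.
have sNX : 'N_X(P) \subset X := subsetIl X _.
rewrite -add1n -(cards1 tt).
apply: (@leq_max_min_gen_nested _ _ [set tt] (fun=> S : {set gT}) X S
  ('N_X(P))%G) => //.
- by rewrite /= defX.
- have nSN : 'N_X(P) \subset 'N(S) := subset_trans sNX nSX.
  by rewrite big_set1 -joingE norm_joinEl // (normC nSN) defX.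
move=> [] _; rewrite setDv big_set0 setU0 genGid.
apply/eqP=> /= eNX; have nPS : P <| S.
  rewrite /normal (pHall_sub sylP) (subset_trans sSX) // -eNX subsetIr //.
case: (simS1 P nPS) => [P1 | defS].
  have := card_Hall sylP; rewrite P1 cards1 => /esym/eqP.
  rewrite p_part -(expn0 p) eqn_exp2l ?prime_gt1 // => /eqP logn0.
  by have := logn_gt0 p #|S|; rewrite logn0 mem_primes p_pr cardG_gt0 pdiv_dvd.
case/negP: (nonabelian_simple_not_pgroup p simS nabS).
by rewrite -defS (pHall_pgroup sylP).
Qed.

(** * The almost simple group induced on a simple factor *)

Section ComponentAutomizer.

Variables (gT : finGroupType) (G N M : {group gT}).
Hypotheses (minN : minnormal N G) (sNG : N \subset G) (nabN : ~~ abelian N).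
Hypotheses (minM : minnormal M N) (sMN : M \subset N).

Local Notation C := 'C_G(M).
Local Notation X := ('N_G(M) / C).

Let sMG : M \subset G := subset_trans sMN sNG.

Lemma component_cent_normal : C <| 'N_G(M).
Proof.
apply/andP; split; first by rewrite setIS // cent_sub.
by rewrite normsI ?norms_cent ?subsetIr // (subset_trans (subsetIl _ _)) ?normG.
Qed.

Let nCN : 'N_G(M) \subset 'N(C) := normal_norm component_cent_normal.

Lemma sub_norm_component : N \subset 'N_G(M).
Proof. by rewrite subsetI sNG; case/mingroupP: minM => /andP[]. Qed.

Let sMT : M \subset 'N_G(M) := subset_trans sMN sub_norm_component.

Lemma component_TI_cent : C :&: M = 1.
Proof.
apply/trivgP; rewrite -(component_center minN sNG nabN minM sMN) subsetI
  subsetIr.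
by rewrite (subset_trans (subsetIl _ _)) // subsetIr.
Qed.

Lemma component_quotient_isog : M \isog M / C.
Proof. by rewrite quotient_isog ?component_TI_cent // (subset_trans sMT). Qed.

Lemma component_quotient_normal : M / C <| X.
Proof. by rewrite quotient_normal // /normal sMT subsetIr. Qed.

Lemma component_quotient_simple : simple (M / C).
Proof.
by rewrite -(isog_simple component_quotient_isog)
  (component_simple minN sNG minM sMN).
Qed.

Lemma component_quotient_nonabelian : ~~ abelian (M / C).
Proof.
by rewrite -(isog_abelian component_quotient_isog)
  (component_nonabelian minN sNG nabN minM sMN).
Qed.

Lemma component_quotient_cent (A : {group gT}) :
  A \subset 'N_G(M) -> A / C \subset 'C(M / C) -> A \subset C.
Proof.
move=> sAT cA; have [sAG nAM] := subsetIP sAT.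
rewrite subsetI sAG; apply/commG1P/trivgP; rewrite -component_TI_cent subsetI.
rewrite -quotient_cents2 ?(subset_trans sAT) ?(subset_trans sMT) //.
by rewrite cA commg_subr.
Qed.

(** If [K] met the simple group [M / C] trivially, the two would commute; but [M / C] has trivial
    centraliser in [X]. *)
Lemma component_quotient_sub (K : {group coset_of C}) :
  K \subset X -> X \subset 'N(K) -> K :!=: 1 -> M / C \subset K.
Proof.
move=> sKX nKX ntK; have [_ simS] := simpleP _ component_quotient_simple.
have sSX := normal_sub component_quotient_normal.
have nsI : K :&: (M / C) <| M / C.
  by rewrite /normal subsetIr normsI ?normG // (subset_trans sSX).
case: (simS (K :&: (M / C))%G nsI) => [tiK | <-]; last exact: subsetIl.
have [A defK sCA sAT] := inv_quotientS component_cent_normal sKX.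
have cK : K \subset 'C(M / C).
  apply/commG1P/trivgP; rewrite -tiK commg_subI // subsetI subxx.
    exact: subset_trans sKX (normal_norm component_quotient_normal).
  exact: subset_trans sSX nKX.
rewrite defK in cK ntK; case/negP: ntK; rewrite -subG1 /=.
by rewrite quotient_sub1 ?component_quotient_cent // (subset_trans sAT).
Qed.

Lemma component_quotient_socle : socle X = M / C.
Proof.
have sSX := normal_sub component_quotient_normal.
have nSX := normal_norm component_quotient_normal.
have [ntS _] := simpleP _ component_quotient_simple.
rewrite /socle; apply/eqP; rewrite eqEsubset gen_subG; apply/andP; split.
  apply/bigcupsP=> K /andP[minK sKX]; case/mingroupP: minK =>
    /andP[ntK nKX] minK.
  have sSK := component_quotient_sub sKX nKX ntK.
  by rewrite -(minK (M / C)%G) // ntS.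
rewrite sub_gen // (bigcup_max (M / C)%G) //= sSX andbT.
apply/mingroupP; rewrite ntS nSX; split=> // K /andP[ntK nKX] sKS.
by apply/eqP; rewrite eqEsubset sKS component_quotient_sub //
  (subset_trans sKS).
Qed.

Lemma component_quotient_almost_simple : almost_simple X.
Proof.
rewrite /almost_simple component_quotient_socle component_quotient_simple.
exact: component_quotient_nonabelian.
Qed.

End ComponentAutomizer.

(** * Counting generators modulo a nonabelian minimal normal subgroup *)

Lemma exists_gen_mod (gT : finGroupType) (G N : {group gT}) (Z : {set gT}) :
    N <| G -> << Z >> = G ->
  exists X : {set gT}, [/\ X \subset Z, #|X| <= max_min_gen (G / N) & N * << X
    >> = G].
Proof.
move=> nsNG genZ; have [sNG nNG] := andP nsNG.
have sZG : Z \subset G by rewrite -genZ subset_gen.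
have nNZ := subset_trans sZG nNG.
have [W minW sWZ] : {W : {set coset_of N} | min_gen_set (G / N) W & W \subset Z
  / N}.
  by apply: minset_exists; rewrite -quotient_gen // genZ.
have [X [sXZ defW oX]] := exists_quotient_lift nNZ sWZ.
exists X; split=> //; first by rewrite oX (leq_max_min_gen (G := (G / N)%G)).
have [genW _] := min_gen_setP (G / N)%G W minW.
have nNX := subset_trans sXZ nNZ.
rewrite -quotientK ?gen_subG // quotient_gen // defW genW /=.
exact: quotientGK.
Qed.

Section NonabelianCount.

Variables (gT : finGroupType) (G N M : {group gT}).
Hypotheses (minN : minnormal N G) (sNG : N \subset G) (nabN : ~~ abelian N).
Hypotheses (minM : minnormal M N) (sMN : M \subset N).

Local Notation C := 'C_G(M).
Local Notation X := ('N_G(M) / C).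

Let nsNG : N <| G := nonabelian_minnormal_normal minN sNG.
Let nNG : G \subset 'N(N) := normal_norm nsNG.
Let nMN : N \subset 'N(M).
Proof. by case/mingroupP: minM => /andP[]. Qed.
Let sNT : N \subset 'N_G(M) := sub_norm_component sNG minM.
Let nCT : 'N_G(M) \subset 'N(C) := normal_norm (component_cent_normal G M).

Lemma component_quotient_N : N / C = M / C.
Proof.
have sCN : 'C_N(M) \subset C by rewrite setSI.
have nCM := subset_trans sMN (subset_trans sNT nCT).
have := congr1 (fun A => A / C) (component_centM minN sNG minM sMN).
rewrite /= quotientMl // => <-; apply/mulGidPl.
by rewrite (subset_trans (quotientS _ sCN)) // trivg_quotient sub1G.
Qed.

(** Put L = [U :&: N]. Its image is normal in [X], and nontrivial because otherwise L would
    centralise every [U]-conjugate of [M]. Hence the image contains the socle [M / C]. *)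
Lemma subdirect_supplement (U : {group gT}) :
    N * U = G -> 'N_U(M) / C = X -> U :&: N != 1 ->
  (U :&: N) * 'C_N(M) = N.
Proof.
move=> defG defX ntL; set L := (U :&: N)%G.
have sUG : U \subset G by rewrite -defG mulG_subr.
have nNU := subset_trans sUG nNG.
have nLU : U \subset 'N(L) by rewrite normsI ?normG.
have sLN : L \subset N := subsetIr U N.
have nCL : L \subset 'N(C) := subset_trans sLN (subset_trans sNT nCT).
have ntLC : L / C != 1.
  apply: contra ntL => /eqP LC1; apply/eqP/trivgP/subsetP=> x Lx; apply/set1gP.
  have sLC : L \subset C by rewrite -quotient_sub1 // LC1.
  apply: (bigcap_component_cent minN sNG nabN minM sMN defG).
    by case/setIP: Lx.
  move=> u Uu; rewrite centJ; have := sLC; rewrite subsetI => /andP[_ sLCM].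
  have Lux : x \in L :^ u by rewrite (normsP nLU u Uu).
  by apply: subsetP Lux; rewrite conjSg.
have sSL : M / C \subset L / C.
  apply: (component_quotient_sub minN sNG nabN minM sMN (K := (L / C)%G)) =>
    //=.
    by rewrite quotientS // (subset_trans sLN).
  by rewrite -defX quotient_norms // (subset_trans (subsetIl _ _)).
have sML : M \subset L * 'C_N(M).
  have -> : L * 'C_N(M) = L * C :&: N.
    by rewrite -group_modl // setIAC (setIidPr sNG).
  rewrite subsetI sMN andbT (normC nCL) -quotientK // -sub_quotient_pre //.
  exact: subset_trans sMN (subset_trans sNT nCT).
have nCNN : N \subset 'N('C_N(M)) by rewrite normsI ?normG ?norms_cent.
apply/eqP; rewrite eqEsubset mul_subG ?subsetIl //=.
rewrite -norm_joinEl in sML *; last exact: subset_trans sLN nCNN.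
rewrite -{1}(component_centM minN sNG minM sMN) mul_subG //.
exact: joing_subr.
Qed.

Section Generators.

Variables (Z X1 : {set gT}).
Hypotheses (minZ : min_gen_set G Z) (sX1Z : X1 \subset Z)
  (defG : N * << X1 >> = G).

Let Y := Z :\: X1.
Local Notation U J := << X1 :|: J >>%G.
Let genZ : << Z >> = G. Proof. by case/min_gen_setP: minZ. Qed.

Lemma genU_Y : U Y = G.
Proof.
apply: val_inj; rewrite /= -genZ; congr << _ >>.
by apply/setP=> x; rewrite !inE; case: (boolP (x \in X1)) => // /(subsetP sX1Z).
Qed.

Lemma genU_S (J K : {set gT}) : J \subset K -> U J \subset U K.
Proof. by move=> sJK; rewrite genS // setUS. Qed.

Lemma genU_sub (J : {set gT}) : J \subset Y -> U J \subset G.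
Proof. by move/genU_S; rewrite genU_Y. Qed.

Lemma genU_mul (J : {set gT}) : J \subset Y -> N * U J = G.
Proof.
move=> sJY; apply/eqP; rewrite eqEsubset mul_subG ?genU_sub //=.
by rewrite -{1}defG mulgS // genS // subsetUl.
Qed.

Lemma genU_notin (J : {set gT}) y : J \subset Y -> y \in Y -> y \notin J ->
  y \notin U J.
Proof.
move=> sJY /setDP[Zy notX1y] notJy; apply: min_gen_set_notin minZ _ Zy _.
  by rewrite subUset sX1Z (subset_trans sJY) ?subsetDl.
by rewrite inE negb_or notX1y.
Qed.

Let H := << X1 >>%G.
(** The [N]-part of [y] in a factorisation along [N * H = G]; the default is reached only for [y]
    outside [G]. *)
Let n y := odflt 1 [pick x in N | x^-1 * y \in H].

Lemma genU_Npart y : y \in G -> n y \in N /\ (n y)^-1 * y \in H.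
Proof.
rewrite -defG => /mulsgP[x h Nx Hh ->]; rewrite /n.
case: pickP => [x' /andP[] // | /(_ x)] /=.
by rewrite Nx mulKg Hh.
Qed.

Let R (J : {set gT}) := << \bigcup_(j in J) n j ^: H >>%G.

(** Replacing each [j] by its [N]-part does not change the group generated together with [H], and
    [H] normalises [R J]. *)
Lemma genU_R (J : {set gT}) : J \subset Y -> U J = R J * H :> {set gT}.
Proof.
move=> sJY; have sJG : J \subset G.
  by rewrite (subset_trans sJY) // (subset_trans (subsetDl _ _)) // -genZ
    subset_gen.
have nRH : H \subset 'N(R J).
  apply: norms_gen; apply/subsetP=> h Hh; rewrite inE.
  apply/subsetP=> _ /imsetP[_ /bigcupP[j Jj /imsetP[k Hk ->]] ->].
  by apply/bigcupP; exists j => //; rewrite -conjgM memJ_class // groupM.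
have sHU : H \subset U J by rewrite genS ?subsetUl.
have nU j : j \in J -> n j \in U J.
  move=> Jj; have [_ Hh] := genU_Npart (subsetP sJG j Jj).
  have Uj : j \in U J by rewrite mem_gen // inE Jj orbT.
  rewrite -[n j](mulgK ((n j)^-1 * j)) mulKVg groupM // groupV.
  exact: (subsetP sHU).
rewrite -norm_joinEr //; apply/eqP; rewrite eqEsubset; apply/andP; split.
  rewrite gen_subG subUset (subset_trans (subset_gen X1) (joing_subr _ _)) /=.
  apply/subsetP=> j Jj; have [_ Hh] := genU_Npart (subsetP sJG j Jj).
  rewrite -(mulKVg (n j) j) groupM //.
    apply: (subsetP (joing_subl _ _)); rewrite mem_gen //.
    by apply/bigcupP; exists j; rewrite ?class_refl.
  exact: (subsetP (joing_subr _ _)).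
rewrite join_subG; apply/andP; split; last exact: sHU.
rewrite gen_subG; apply/bigcupsP=> j Jj; apply/subsetP=> _ /imsetP[h Hh ->].
by rewrite groupJ ?nU ?(subsetP sHU).
Qed.

(** [R J] lies in [N], which normalises [M], so the modular law gives
    ['N_(U J)(M) = R J * 'N_H(M)]. *)
Lemma genU_normalizer (J : {set gT}) : J \subset Y ->
  'N_(U J)(M) / C = << 'N_H(M) / C :|: \bigcup_(j in J) (n j ^: H) / C >>.
Proof.
move=> sJY; have sJG : J \subset G.
  by rewrite (subset_trans sJY) // (subset_trans (subsetDl _ _)) // -genZ
    subset_gen.
have sHG : H \subset G by rewrite -defG mulG_subr.
have sHU : H \subset U J by rewrite genS ?subsetUl.
have sclN j : j \in J -> n j ^: H \subset N.
  move=> Jj; apply/subsetP=> _ /imsetP[h Hh ->].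
  have [Nn _] := genU_Npart (subsetP sJG j Jj).
  by rewrite memJ_norm // (subsetP nNG) // (subsetP sHG).
have sRN : R J \subset N by rewrite gen_subG; apply/bigcupsP=> j /sclN.
have sRT := subset_trans sRN sNT.
have sRU : R J \subset U J by rewrite genU_R // mulG_subl.
have defNU : 'N_(U J)(M) = R J * 'N_H(M).
  by rewrite group_modl ?(subset_trans sRN) // -genU_R.
apply/eqP; rewrite eqEsubset; apply/andP; split.
  rewrite defNU quotientMl ?(subset_trans sRT) // mul_subG //.
    rewrite quotient_gen; last by rewrite (subset_trans (subset_gen _)) //
      (subset_trans sRT).
    apply: genS; apply/subsetP=> _ /morphimP[x Nx /bigcupP[j Jj Rx] ->].
    by apply/setUP; right; apply/bigcupP; exists j; rewrite ?mem_morphim.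
  by rewrite sub_gen ?subsetUl.
rewrite gen_subG subUset quotientS ?setSI //=; apply/bigcupsP=> j Jj.
rewrite quotientS // subsetI andbC (subset_trans (sclN j Jj)) //=.
by rewrite (subset_trans _ sRU) // sub_gen // (bigcup_max j).
Qed.

(** For [J] minimal such that ['N_(U J)(M)] covers [X], the images of the classes [n j ^: H] are
    irredundant over ['N_H(M) / C], as [leq_max_min_gen_nested] requires. *)
Lemma exists_full_normalizer : exists2 J : {set gT}, J \subset Y &
  'N_(U J)(M) / C = X /\ #|J| + max_min_gen (X / (M / C)) <= max_min_gen X.
Proof.
have sHG : H \subset G by rewrite -defG mulG_subr.
have PY : 'N_(U Y)(M) / C == X by rewrite genU_Y.
have [J /minsetP[/eqP PJ minJ] sJY] :
    {J : {set gT} | minset (fun J => 'N_(U J)(M) / C == X) J & J \subset Y}.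
  exact: (@minset_exists _ (fun J => 'N_(U J)(M) / C == X) Y PY).
exists J => //; split=> //.
apply: (@leq_max_min_gen_nested _ _ J (fun j => (n j ^: H) / C) X%G (M / C)%G
         ('N_H(M) / C)%G).
- exact: component_quotient_normal sNG minM sMN.
- by rewrite quotientS ?setSI.
- rewrite /= -component_quotient_N -quotientMl ?(subset_trans sNT) //.
  by rewrite quotientS // group_modl // defG.
- move=> j Jj /=; rewrite -component_quotient_N quotientS //.
  apply/subsetP=> _ /imsetP[h Hh ->].
  have Gj : j \in G.
    by rewrite -genZ mem_gen //; have := subsetP sJY j Jj; case/setDP.
  have [Nn _] := genU_Npart Gj.
  by rewrite memJ_norm // (subsetP nNG) // (subsetP sHG).
- by rewrite /= -genU_normalizer.
move=> j Jj /=; have sDJ : J :\ j \subset J := subsetDl J _.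
rewrite -genU_normalizer ?(subset_trans sDJ) //; apply/negP=> PJj.
by have := setD11 j J; rewrite (minJ _ PJj sDJ) Jj.
Qed.

(* If U J :&: N is trivial then J is empty; a single generator then suffices,
   and m(X) > m(X / S). *)
Lemma exists_subdirect : exists2 J : {set gT}, J \subset Y &
  (U J :&: N) * 'C_N(M) = N /\
  #|J| + max_min_gen (X / (M / C)) <= max_min_gen X.
Proof.
have [J sJY [PJ leJ]] := exists_full_normalizer.
have [UN1 | ntUN] := eqVneq (U J :&: N) 1; last first.
  by exists J => //; split=> //; apply: subdirect_supplement; rewrite ?genU_mul.
have sYG : Y \subset G by rewrite (subset_trans (subsetDl _ _)) // -genZ
  subset_gen.
have n_neq1 j : j \in Y -> n j != 1.
  move=> Yj; have [_] := genU_Npart (subsetP sYG j Yj).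
  apply: contraTneq => ->; rewrite invg1 mul1g.
  have := genU_notin (sub0set Y) Yj; rewrite in_set0 /= setU0; exact.
have n_in (K : {set gT}) j : K \subset Y -> j \in K -> n j \in U K :&: N.
  move=> sKY Kj; have [Nn Hn] := genU_Npart (subsetP sYG j (subsetP sKY j Kj)).
  rewrite inE Nn andbT -[n j](mulgK ((n j)^-1 * j)) mulKVg groupM //.
    by rewrite mem_gen // inE Kj orbT.
  by rewrite groupV; apply: subsetP Hn; rewrite genS ?subsetUl.
(* Any [j] in [J] would give the nontrivial element [n j] of [U J :&: N]. *)
have J0 : J = set0.
  apply/eqP; apply: contraT => /set0Pn[j Jj].
  by case/negP: (n_neq1 j (subsetP sJY j Jj)); have := n_in J j sJY Jj;
    rewrite UN1 inE.
have [Y0 | [y Yy]] := set_0Vmem Y.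
  have : U J = G by rewrite J0 -genU_Y Y0.
  case/mingroupP: minN => /andP[ntN _] _ eUG.
  by case/negP: ntN; rewrite -UN1 eUG; apply/eqP/esym/setIidPr.
have sy : [set y] \subset Y by rewrite sub1set.
exists [set y] => //; split.
  apply: subdirect_supplement; first exact: genU_mul.
    apply/eqP; rewrite eqEsubset quotientS ?setSI ?genU_sub //= -PJ quotientS //
      setSI //.
    by rewrite J0 genU_S ?sub0set.
  apply: contra (n_neq1 y Yy) => /eqP UN1y.
  by have := n_in _ _ sy (set11 y); rewrite UN1y inE.
rewrite cards1 add1n; apply: ltn_max_min_gen_simple.
- exact: component_quotient_normal sNG minM sMN.
- exact: component_quotient_simple minN sNG nabN minM sMN.
- exact: component_quotient_nonabelian minN sNG nabN minM sMN.
Qed.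

(* Here J runs through a chain from J1 to Y, and V J is the stabiliser in G of
   the diagonal block of U J :&: N through M. *)
Lemma double_cosets_subdirect (p q : nat) (P Q : {group gT}) (J1 : {set gT}) :
    p != q -> p.-group P -> q.-group Q -> J1 \subset Y ->
    (U J1 :&: N) * 'C_N(M) = N ->
  #|Y :\: J1| + 2 <= #|double_cosets 'N_G(M) G P| + #|double_cosets 'N_G(M) G
    Q|.
Proof.
move=> neq_pq pP qQ sJ1Y subJ1.
pose L J := (U J :&: N)%G; pose W J := 'N_(U J1)('C_(L J)(M))%G.
have sLN J : L J \subset N := subsetIr _ N.
have sUG (J : {set gT}) : J \subset Y -> U J \subset G := @genU_sub J.
have nLU (J : {set gT}) : J1 \subset J -> J \subset Y -> U J1 \subset 'N(L J).
  move=> sJ1J sJY; apply: normsI.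
    exact: subset_trans (genU_S sJ1J) (normG _).
  exact: subset_trans (sUG _ sJ1Y) nNG.
have subL (K : {set gT}) : J1 \subset K -> K \subset Y -> L K * 'C_N(M) = N.
  move=> sJ1J sJY; apply/eqP;
    rewrite eqEsubset (mul_subG (sLN _) (subsetIl _ _)) /=.
  by rewrite -{1}subJ1 mulSg // setSI // genU_S.
have sL1W (J : {set gT}) : J1 \subset J -> N :&: U J1 \subset W J.
  move=> sJ1J; have sLL : N :&: U J1 \subset L J by rewrite setIC setSI //
    genU_S.
  rewrite subsetI subsetIr; apply: normsI.
    exact: subset_trans sLL (normG _).
  by rewrite norms_cent // (subset_trans (subsetIl _ _)).
pose V J := (N <*> W J)%G.
have defV J : V J = N * W J :> {set gT}.
  apply: norm_joinEr; apply: subset_trans (subsetIl _ _) _.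
  exact: subset_trans (sUG _ sJ1Y) nNG.
have sVG J : V J \subset G.
  rewrite join_subG sNG; exact: subset_trans (subsetIl _ _) (sUG _ sJ1Y).
(* By the modular law [U K = L K * U J]; so [L K] inside [L J] would put the new generator [y] in
   [U J]. *)
have properL (J K : {set gT}) : J1 \subset J -> J \proper K -> K \subset Y ->
  L J \proper L K.
  move=> sJ1J /properP[sJK [y Ky notJy]] sKY; rewrite properE setSI ?genU_S //=.
  have Yy := subsetP sKY y Ky; have sJY := subset_trans sJK sKY.
  apply: contra (genU_notin sJY Yy notJy) => sLKJ.
  have Uy : y \in U K by rewrite mem_gen // inE Ky orbT.
  have : y \in U K :&: (N * U J) by rewrite inE Uy genU_mul
    ?(subsetP (sUG _ sKY)).
  rewrite -group_modr ?genU_S // => /mulsgP[x u /setIP[Ux Nx] Uu ->].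
  rewrite groupM // (subsetP (subset_trans sLKJ (subsetIl _ _))) //.
  by rewrite inE Ux.
have properV (J K : {set gT}) : J1 \subset J -> J \proper K -> K \subset Y ->
  V K \proper V J.
  move=> sJ1J ltJK sKY; have sJK := proper_sub ltJK; have sJY := subset_trans
    sJK sKY.
  have sJ1K := subset_trans sJ1J sJK.
  have := subdirect_stab_proper minN sNG nabN minM sMN (genU_mul sJ1Y) (sLN J)
    (sLN K)
    (nLU J sJ1J sJY) (nLU K sJ1K sKY) (subL J sJ1J sJY) (subL K sJ1K sKY)
      (properL J K sJ1J ltJK sKY).
  (* Strictness survives multiplication by [N]: as [N :&: U J1] lies in [W K], the group [V K] meets
     [U J1] exactly in [W K]. *)
  rewrite !properE => /andP[sWKJ not_sWJK].
  rewrite genS ?setUS //=; apply: contra not_sWJK => sVJK.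
  have : W J \subset U J1 :&: (N * W K).
    by rewrite subsetI subsetIl -defV (subset_trans (joing_subr N (W J))).
  rewrite -group_modr ?subsetIl // => /subset_trans; apply.
  by rewrite mul_subG // setIC sL1W.
have main k (J : {set gT}) : #|J :\: J1| = k -> J1 \subset J -> J \subset Y ->
    k + 2 <= #|double_cosets (V J) G P| + #|double_cosets (V J) G Q|.
  elim: k J => [|k IHk] J oJ sJ1J sJY.
    (* Each of the two sets of double cosets is nonempty; this is the summand 2. *)
    by rewrite (leq_add (double_cosets_gt0 _ _ _) (double_cosets_gt0 _ _ _)).
  have [y yJ] : exists y, y \in J :\: J1 by apply/card_gt0P; rewrite oJ.
  have [Jy notJ1y] := setDP yJ.
  have oJy : #|(J :\ y) :\: J1| = k.
    apply/eqP; rewrite -eqSS -oJ (cardsD1 y (J :\: J1)) yJ eqSS; apply/eqP.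
    by apply: eq_card => x; rewrite !inE andbCA.
  have sJ1Jy : J1 \subset J :\ y by rewrite subsetD1 sJ1J.
  have ltJy : J :\ y \proper J := properD1 Jy.
  have := IHk _ oJy sJ1Jy (subset_trans (subsetDl _ _) sJY).
  move=> leJy; rewrite addSn (leq_ltn_trans leJy) //.
  exact: (ltn_double_cosets neq_pq pP qQ (properV _ _ sJ1Jy ltJy sJY) (sVG _)).
(* At the end of the chain [L Y = N], and normalising ['C_N(M)] amounts to normalising [M]. *)
have sTV : 'N_G(M) \subset V Y.
  have eLY : L Y = N by apply: val_inj; rewrite /L genU_Y /= (setIidPr sNG).
  have sTW : 'N_(U J1)(M) \subset W Y.
    rewrite /W eLY subsetI subsetIl (subset_trans (setSI _ (sUG _ sJ1Y))) //.
    by rewrite -(norm_component_subcent minN sNG nabN minM sMN) subsetIr.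
  by rewrite defV -{1}(genU_mul sJ1Y) -group_modl // mulgS.
apply: leq_trans (main _ Y erefl sJ1Y (subxx _)) _.
exact: leq_add (leq_double_cosets G P sTV) (leq_double_cosets G Q sTV).
Qed.

End Generators.

Lemma nonabelian_minnormal_count : exists e,
  max_min_gen G + max_min_gen (X / (M / C)) <= max_min_gen (G / N) + max_min_gen
    X + e /\
  forall (p q : nat) (P Q : {group gT}), p != q -> p.-group P -> q.-group Q ->
    e + 2 <= #|double_cosets 'N_G(M) G P| + #|double_cosets 'N_G(M) G Q|.
Proof.
have [Z minZ <-] := max_min_gen_witness G.
have [genZ _] := min_gen_setP _ _ minZ.
have [X1 [sX1Z leX1 defG]] := exists_gen_mod nsNG genZ.
have [J sJY [subJ leJ]] := exists_subdirect minZ sX1Z defG.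
(* [e] counts the generators outside both [X1] and [J]. *)
exists #|(Z :\: X1) :\: J|; split; last first.
  move=> p q P Q neq_pq pP qQ.
  exact: (double_cosets_subdirect minZ sX1Z defG neq_pq pP qQ sJY subJ).
rewrite -(cardsID X1 Z) (setIidPr sX1Z) -(cardsID J (Z :\: X1)) (setIidPr sJY).
rewrite addnA -!addnA [_ + max_min_gen _]addnC !addnA leq_add2r -addnA.
by rewrite leq_add.
Qed.

End NonabelianCount.

(** * Ranks of Sylow subgroups *)

Section SylowRank.

Variable gT : finGroupType.
Implicit Types G N P : {group gT}.

Lemma sylow_rankE (p : nat) G P : p.-Sylow(G) P -> sylow_rank p G = 'm(P).
Proof.
rewrite /sylow_rank; case: (Sylow_exists p G) => Q sylQ /= sylP.
have [x _ ->] := Sylow_trans sylQ sylP.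
exact: isog_grank (conj_isog Q x).
Qed.

Lemma sylow_rank_Sylow (p : nat) G :
  exists2 P : {group gT}, p.-Sylow(G) P & sylow_rank p G = 'm(P).
Proof.
by have [P sylP] := Sylow_exists p G; exists P; rewrite // (sylow_rankE sylP).
Qed.

End SylowRank.

Section SumSylowRank.

Variables (gT : finGroupType) (G N : {group gT}).
Hypothesis nsNG : N <| G.

Lemma sylow_rank_quotient (p : nat) (P : {group gT}) :
  p.-Sylow(G) P -> sylow_rank p (G / N)%G = 'm(P / N).
Proof.
move=> sylP; apply: (sylow_rankE (P := (P / N)%G)).
by apply: quotient_pHall => //; apply: subset_trans (pHall_sub sylP)
  (normal_norm nsNG).
Qed.

Lemma leq_sum_sylow_rank_quotient (f : nat -> nat) :
    (forall p, p \in primes #|G| ->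
       sylow_rank p (G / N)%G + f p <= sylow_rank p G) ->
  sum_sylow_rank (G / N)%G + \sum_(p <- primes #|G|) f p <= sum_sylow_rank G.
Proof.
move=> lef; rewrite /sum_sylow_rank.
apply: (@leq_trans (\sum_(p <- primes #|G|) (sylow_rank p (G / N)%G + f p))).
  rewrite big_split leq_add2r /=.
  (* Primes of |G| that do not divide |G / N| only add nonnegative terms. *)
  apply: (uniq_sub_le_big leqnn) => [x y|||p];
    rewrite ?primes_uniq ?leq_addr //.
  by apply: pi_of_dvd; rewrite ?cardG_gt0 ?dvdn_quotient.
by rewrite !big_seq; apply: leq_sum.
Qed.

Lemma leq_sylow_rank_quotient (p : nat) :
  sylow_rank p (G / N)%G <= sylow_rank p G.
Proof.
have [P sylP ->] := sylow_rank_Sylow p G; rewrite (sylow_rank_quotient sylP).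
by rewrite quotient_grank // (subset_trans (pHall_sub sylP)) ?normal_norm.
Qed.

End SumSylowRank.

(** * Passing from [G / N] to [G] for a minimal normal subgroup [N] *)

Lemma abelian_minnormal_count (gT : finGroupType) (G N : {group gT}) :
    minnormal N G -> N \subset G -> abelian N ->
  exists c, max_min_gen G <= max_min_gen (G / N) + c /\
            sum_sylow_rank (G / N)%G + c <= sum_sylow_rank G.
Proof.
move=> minN sNG abN; have /andP[ntN nNG] := mingroupp minN.
have nsNG : N <| G by rewrite /normal sNG.
have [Z minZ <-] := max_min_gen_witness G.
have [genZ minZ1] := min_gen_setP _ _ minZ.
have [X1 [sX1Z leX1 defG]] := exists_gen_mod nsNG genZ.
have sZG : Z \subset G by rewrite -genZ subset_gen.
have [defZ | [z /setDP[Zz notX1z]]] := set_0Vmem (Z :\: X1).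
  exists 0; rewrite !addn0; split.
    by rewrite (leq_trans _ leX1) // subset_leq_card // -setD_eq0 defZ.
  have := @leq_sum_sylow_rank_quotient _ G N (fun=> 0).
  by rewrite big1 // addn0; apply=> p _; rewrite addn0 leq_sylow_rank_quotient.
pose H := << X1 >>%G; have defG1 : N * H = G by [].
have sHG : H \subset G by rewrite -defG1 mulG_subr.
have notHz : z \notin H by apply: min_gen_set_notin minZ sX1Z Zz notX1z.
(* [N :&: K] is normalised by [H] and centralised by the abelian group [N]. *)
have nsI (K : {group gT}) : H \subset K -> K \subset G -> G \subset 'N(N :&: K).
  move=> sHK sKG; rewrite -defG1 mul_subG //.
    by rewrite cents_norm // centsC (subset_trans (subsetIl _ _)).
  exact: normsI (subset_trans sHG nNG) (subset_trans sHK (normG K)).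
have maxI (K : {group gT}) : H \subset K -> K \subset G -> N :&: K != 1 ->
  K :=: G.
  move=> sHK sKG ntI; apply/eqP; rewrite eqEsubset sKG -defG1 mul_subG //.
  have <- : N :&: K = N; last exact: subsetIr.
  have [_ minN1] := mingroupP minN.
  by apply: (minN1 (N :&: K)%G); rewrite /= ?subsetIl // ntI nsI.
have tiNH : N :&: H = 1.
  by apply/eqP; apply: contraNT notHz => /(maxI H (subxx _) sHG)->;
    apply: (subsetP sZG).
(* One generator beyond [X1] suffices: the [N]-part [x] of [z] is nontrivial, and a subgroup
   containing [H] that meets [N] nontrivially is [G]. Hence [c] is 1 below. *)
have defZ : z |: X1 = Z.
  apply: minZ1; first by rewrite subUset sub1set Zz.
  apply: (maxI << z |: X1 >>%G); first by rewrite genS ?subsetUr.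
    by rewrite -genZ genS // subUset sub1set Zz.
  have Gz : z \in N * H by rewrite defG1 (subsetP sZG).
  case/mulsgP: Gz => x h Nx Hh def_z; apply: contraNneq notHz => I1.
  have : x \in N :&: << z |: X1 >>.
    rewrite inE Nx -[x](mulgK h) -def_z groupM //; first by rewrite mem_gen
      ?setU11.
    by rewrite groupV; apply: subsetP Hh; rewrite genS ?subsetUr.
  by rewrite I1 def_z => /set1gP->; rewrite mul1g.
exists 1%N; split; first by rewrite -defZ cardsU1 notX1z addnC leq_add2r.
have [_ _ /is_abelemP[p p_pr abelN]] := minnormal_solvable minN (subxx N)
  (abelian_sol abN).
have pN := abelem_pgroup abelN.
have pG : p \in primes #|G|.
  have [_ pN1 _] := pgroup_pdiv pN ntN.
  by rewrite mem_primes p_pr cardG_gt0 (dvdn_trans pN1 (cardSg sNG)).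
have := @leq_sum_sylow_rank_quotient _ G N (fun q => q == p).
rewrite (bigD1_seq p) ?primes_uniq //= eqxx big1 ?addn0; last by move=>
  q /negPf->.
apply=> q _; have [->{q} | _] := eqVneq q p;
  last by rewrite addn0 leq_sylow_rank_quotient.
have [P sylP ->] := sylow_rank_Sylow p G.
rewrite (sylow_rank_quotient nsNG sylP) addn1.
have sNP : N \subset P by rewrite (subset_trans _ (pcore_sub_Hall sylP)) //
  pcore_max.
have pP := pHall_pgroup sylP; have sPG := pHall_sub sylP.
apply: (ltn_grank_quotient pP).
  by rewrite /normal sNP (subset_trans sPG).
apply: contra ntN => sNPhi.
(* [P] is generated by [N] and [P :&: H]. If [N] lay in ['Phi(P)], it could be dropped, so [P] and
   hence [N] would lie in [H], against [tiNH]. *)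
have defP : P :&: H = P.
  rewrite -[LHS]genGid (@Phi_nongen _ P) //; apply/eqP.
  rewrite eqEsubset join_subG Phi_sub subsetIl /=.
  have {1}<- : N * (P :&: H) = P by rewrite setIC group_modl // defG1;
    apply/setIidPr.
  by rewrite mul_subG ?joing_subr // (subset_trans sNPhi) ?joing_subl.
by rewrite -subG1 -tiNH subsetI subxx (subset_trans sNP) //; apply/setIidPl.
Qed.

Lemma nonabelian_minnormal_rank (gT : finGroupType) (G N M : {group gT}) :
    minnormal N G -> N \subset G -> ~~ abelian N -> minnormal M N ->
      M \subset N ->
  exists e,
    max_min_gen G + max_min_gen ('N_G(M) / 'C_G(M) / (M / 'C_G(M)))
      <= max_min_gen (G / N) + max_min_gen ('N_G(M) / 'C_G(M)) + e /\
    sum_sylow_rank (G / N)%G + num_primes M + e <= sum_sylow_rank G.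
Proof.
move=> minN sNG nabN minM sMN.
have nsNG := nonabelian_minnormal_normal minN sNG.
have [e [le_e dc_e]] := nonabelian_minnormal_count minN sNG nabN minM sMN.
exists e; split=> //.
pose dc p := #|double_cosets 'N_G(M) G (sval (Sylow_exists p G))|.
have dc_gt0 p : 0 < dc p := double_cosets_gt0 _ _ _.
have sMG := subset_trans sMN sNG.
have le_sum : sum_sylow_rank (G / N)%G + \sum_(p <- primes #|M|) dc p <=
  sum_sylow_rank G.
  have -> : \sum_(p <- primes #|M|) dc p =
            \sum_(p <- primes #|G|) (if p \in primes #|M| then dc p else 0).
    rewrite -big_mkcond -[RHS]big_filter; apply: perm_big; apply: uniq_perm.
    - exact: primes_uniq.
    - by rewrite filter_uniq ?primes_uniq.
    move=> p; rewrite mem_filter; apply/idP/andP=> [Mp | []//]; split=> //.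
    by apply: pi_of_dvd Mp; rewrite ?cardG_gt0 ?cardSg.
  apply: leq_sum_sylow_rank_quotient => // p Gp.
  case: ifP => [Mp | _]; last by rewrite addn0 leq_sylow_rank_quotient.
  rewrite /dc; case: (Sylow_exists p G) => P sylP /=.
  rewrite (sylow_rank_quotient nsNG sylP) (sylow_rankE sylP).
  move: Mp; rewrite mem_primes => /and3P[p_pr _ pM].
  exact: (Sylow_grank_components minN sNG nabN minM sMN p_pr sylP pM).
apply: leq_trans le_sum; rewrite -addnA leq_add2l /num_primes.
have nabM := component_nonabelian minN sNG nabN minM sMN.
have simM := component_simple minN sNG minM sMN.
have := primes_uniq #|M|; have all_p : all prime (primes #|M|).
  by apply/allP=> p; rewrite mem_primes => /andP[].
have not_pM p : ~~ all (pred1 p) (primes #|M|).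
  apply: contra (nonabelian_simple_not_pgroup p simM nabM) => /allP allp.
  by rewrite /pgroup /pnat cardG_gt0; apply/allP=> q /allp.
(* |M| has at least two prime divisors. Two of them account for [e + 2] orbits and each further one
   for at least one orbit. *)
case: (primes #|M|) all_p not_pM => [|p [|q s]] //=.
- by move=> _ /(_ 0).
- by move=> _ /(_ p); rewrite eqxx.
move=> _ _ /andP[]; rewrite inE negb_or => /andP[neq_pq _] _.
rewrite !big_cons addnA.
have le1 : e + 2 <= dc p + dc q.
  rewrite /dc; case: (Sylow_exists p G) => P sylP; case: (Sylow_exists q G) =>
    Q sylQ /=.
  exact: dc_e neq_pq (pHall_pgroup sylP) (pHall_pgroup sylQ).
have le2 : size s <= \sum_(r <- s) dc r.
  by rewrite -sum1_size; apply: leq_sum => r _.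
by rewrite -addn2 -addnA addnC [2 + e]addnC leq_add.
Qed.

(** * Composition factors obtained from normal subgroups and quotients *)

Section CompositionFactors.

Variable gT : finGroupType.
Implicit Types G H K : {group gT}.

Lemma exists_maxnormal_series G H : H <| G ->
  exists2 s : seq {group gT},
    path [rel x y : {group gT} | maxnormal y x x] G s & last G s = H.
Proof.
have [n] := ubnP #|G|; elim: n G => // n IHn G /ltnSE leGn nsHG.
have [sHG nHG] := andP nsHG.
have [-> | neqHG] := eqVneq H G; first by exists [::].
have ltHG : (H \proper G) && (G \subset 'N(H)) by rewrite properEneq neqHG sHG.
have [L maxL sHL] := maxgroup_exists
  (gP := fun L => (L \proper G) && (G \subset 'N(L))) ltHG.
have ltLG := maxnormal_proper maxL.
have [||s path_s last_s] := IHn L.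
- by rewrite (leq_trans _ leGn) // proper_card.
- exact: normalS sHL (proper_sub ltLG) nsHG.
by exists (L :: s) => //=; apply/andP; split.
Qed.

(** A series from [G] down to [H], the step from [H] to [K], and a composition series of [K]
    concatenate to a composition series of [G]. *)
Lemma composition_factor_normal (sT : finGroupType) (S : {group sT}) G H K :
  H <| G -> maxnormal K H H -> S \isog H / K -> composition_factor G S.
Proof.
move=> nsHG maxK isoS; have [s path_s last_s] := exists_maxnormal_series nsHG.
have [t comps_t] := exists_comps K.
exists (s ++ K :: t); apply/andP; split.
  have [/eqP last_t path_t] := andP comps_t.
  apply/compsP; split; first by rewrite last_cat last_s.
  by rewrite cat_path path_s last_s /= maxK.
apply/hasP; exists (section_repr (mkSec H K)).
  apply: map_f; rewrite pairmap_cat mem_cat last_s /= inE eqxx orbT //.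
exact: isog_trans isoS (isog_symr (section_reprP (mkSec H K))).
Qed.

(** By the correspondence and third isomorphism theorems; this carries the hypothesis on factors
    from [G] to [G / N]. *)
Lemma quotient_normal_factor (sT : finGroupType) (S : {group sT}) G
  (N : {group gT})
    (H K : {group coset_of N}) :
    N <| G -> H <| G / N -> maxnormal K H H -> S \isog H / K ->
  exists H1 K1 : {group gT}, [/\ H1 <| G, maxnormal K1 H1 H1 & S \isog H1 / K1].
Proof.
move=> nsNG nsHG maxK isoS; have nsKH := maxnormal_normal maxK.
have [H1 defH sNH1 nsH1G] := inv_quotientN nsNG nsHG.
have nsNH1 : N <| H1 := normalS sNH1 (normal_sub nsH1G) nsNG.
have nsK : K <| H1 / N by rewrite -defH.
have [K1 defK sNK1 nsK1H1] := inv_quotientN nsNH1 nsK.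
have iso : H / K \isog H1 / K1.
  have := third_isog sNK1 nsNH1 nsK1H1.
  have eH : H = (H1 / N)%G by apply: val_inj.
  have eK : K = (K1 / N)%G by apply: val_inj.
  by rewrite eH eK.
exists H1, K1; split=> //; last exact: isog_trans isoS iso.
by rewrite -quotient_simple // -(isog_simple iso) quotient_simple.
Qed.

End CompositionFactors.

Lemma component_factor (gT : finGroupType) (G N M : {group gT}) :
    minnormal N G -> N \subset G -> ~~ abelian N -> minnormal M N ->
      M \subset N ->
  maxnormal 'C_N(M) N N /\ M \isog N / 'C_N(M).
Proof.
move=> minN sNG nabN minM sMN.
have defN : N * 'C_N(M) = N by rewrite mulGSid ?subsetIl.
have [/andP[maxC _] _] := component_proj_maxnormal minN sNG nabN minM sMN
  (subxx N) defN.
split=> //; rewrite isog_sym.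
exact: (component_proj_isog minN sNG nabN minM sMN (subxx N) defN).
Qed.

(** * Superadditivity and the induction on the group order *)

Import Order.TTheory GRing.Theory Num.Theory.
Local Open Scope ring_scope.

(** For x = a and x = b, write x^r = x x^(r-1) and bound it by x (a+b)^(r-1); then add. *)
Lemma powR_superadditive (R : realType) (a b r : R) :
  0 <= a -> 0 <= b -> 1 <= r -> a `^ r + b `^ r <= (a + b) `^ r.
Proof.
move=> a0 b0 r1; have r0 : 0 < r by apply: lt_le_trans r1.
have ab0 : 0 <= a + b by apply: addr_ge0.
have mono x : 0 <= x -> x <= a + b -> x `^ r <= x * (a + b) `^ (r - 1).
  move=> x0 lex; rewrite -(mulr_powRB1 x0 r0) ler_wpM2l //.
  by apply: ge0_ler_powR; rewrite ?subr_ge0 ?nnegrE.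
rewrite -(mulr_powRB1 ab0 r0) mulrDl lerD // mono ?lerDl ?lerDr //.
Qed.

Lemma ler_natr_powR (R : realType) (n : nat) (r : R) : 1 <= r ->
  n%:R <= n%:R `^ r.
Proof.
move=> r1; case: n => [|n]; first exact: powR_ge0.
by apply: le1r_powR => //; rewrite ler1n.
Qed.

(* Stated with factors H / K such that H is normal in G, because this hypothesis
   passes directly to quotients. *)
Lemma max_min_gen_bound (R : realType) (sigma eta : R)
    (gT : finGroupType) (G : {group gT}) :
    1 <= sigma -> 1 <= eta ->
    (forall (sT : finGroupType) (S : {group sT}) (H K : {group gT}),
       (H <| G)%g -> maxnormal K H H -> (S \isog H / K)%g ->
       forall (xT : finGroupType) (X : {group xT}),
         almost_simple X -> (socle X \isog S)%g ->
         (rel_max_min_gen X (socle X))%:~R <= sigma *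
           ((num_primes S)%:R `^ eta)) ->
  (max_min_gen G)%:R <= sigma * ((sum_sylow_rank G)%:R `^ eta).
Proof.
move=> s1 e1; have s0 : 0 <= sigma by apply: le_trans s1.
have e0 : 0 <= eta by apply: le_trans e1.
have [n] := ubnP #|G|; elim: n gT G => // n IHn gT G /ltnSE leGn factors.
have [G1 | ntG] := eqVneq (G : {set gT}) 1%g.
  have [Z /min_gen_setP[genZ minZ] <-] := max_min_gen_witness G.
  suff <- : set0 = Z by rewrite cards0 mulr_ge0 ?powR_ge0.
  by apply: minZ; rewrite ?sub0set // gen0 G1.
have [N minN sNG] := minnormal_exists ntG (normG G).
have /andP[ntN nNG] := mingroupp minN.
have nsNG : (N <| G)%g by rewrite /normal sNG.
have IH : (max_min_gen (G / N)%g)%:R <= sigma *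
  ((sum_sylow_rank (G / N)%G)%:R `^ eta).
  apply: (IHn _ (G / N)%G) => [|sT S H K nsH maxK isoS xT X asX isoX].
    by rewrite (leq_trans _ leGn) // ltn_quotient.
  have [H1 [K1 [nsH1 maxK1 isoS1]]] := quotient_normal_factor nsNG nsH maxK
    isoS.
  exact: (factors sT S H1 K1).
(* Superadditivity absorbs an additive term [a] once the rank sum has grown by a matching [c]. With
   [le_sigma] it applies to the number of extra generators. *)
have combine (a b c d : nat) : (b + c <= d)%N ->
    (a%:R : R) <= sigma * c%:R `^ eta ->
    sigma * b%:R `^ eta + a%:R <= sigma * d%:R `^ eta.
  move=> lebcd lea; apply: le_trans (lerD (lexx _) lea) _.
  rewrite -mulrDr ler_wpM2l //.
  apply: le_trans (powR_superadditive (ler0n _ b) (ler0n _ c) e1) _.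
  by apply: ge0_ler_powR; rewrite ?nnegrE ?addr_ge0 // -natrD ler_nat.
have le_sigma (c : nat) : (c%:R : R) <= sigma * c%:R `^ eta.
  by rewrite -[X in X <= _]mul1r ler_pM // ler_natr_powR.
have [abN | nabN] := boolP (abelian N).
  have [c [le_m le_d]] := abelian_minnormal_count minN sNG abN.
  apply: le_trans (combine c _ c _ le_d (le_sigma c)).
  apply: le_trans (_ : (max_min_gen (G / N)%g)%:R + c%:R <= _);
    last by rewrite lerD.
  by rewrite -natrD ler_nat.
have [M minM sMN] := minnormal_exists ntN (normG N).
have [maxC isoM] := component_factor minN sNG nabN minM sMN.
have [e [le_m le_d]] := nonabelian_minnormal_rank minN sNG nabN minM sMN.
have asX := component_quotient_almost_simple minN sNG nabN minM sMN.
have socX := component_quotient_socle minN sNG nabN minM sMN.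
have isoX : (socle ('N_G(M) / 'C_G(M)) \isog M)%g.
  by rewrite socX isog_sym (component_quotient_isog minN sNG nabN minM sMN).
(* The hypothesis is used for the factor [N / 'C_N(M)] of [G], which is isomorphic to [M]. *)
have := factors gT M N ('C_N(M))%G nsNG maxC isoM _ ('N_G(M) / 'C_G(M))%G asX
  isoX.
rewrite /= socX /rel_max_min_gen intrD intrN => le_rel.
apply: le_trans (combine e _ e _ le_d (le_sigma e)).
rewrite natrD; apply: le_trans
  (_ : _ <= sigma * (sum_sylow_rank (G / N)%G)%:R `^ eta
   + sigma * (num_primes M)%:R `^ eta + e%:R) _; last first.
  rewrite lerD2r -mulrDr ler_wpM2l // powR_superadditive //.
apply: le_trans (lerD (lerD IH le_rel) (lexx _)).
move: le_m; rewrite -(ler_nat R) !natrD => le_m.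
lra.
Qed.

Theorem theorem1p3 (R : realType) (gT : finGroupType) (G : {group gT})
    (sigma eta : R) (hsigma : 1 <= sigma) (heta : 2 <= eta)
    (hfactors : forall (sT : finGroupType) (S : {group sT}),
       composition_factor G S ->
       forall (xT : finGroupType) (X : {group xT}),
         almost_simple X -> (socle X \isog S)%g ->
         (rel_max_min_gen X (socle X))%:~R
           <= sigma * ((num_primes S)%:R `^ eta)) :
  (max_min_gen G)%:R <= sigma * ((sum_sylow_rank G)%:R `^ eta).

Proof.
have e1 : 1 <= eta by apply: le_trans heta; rewrite ler1n.
apply: max_min_gen_bound hsigma e1 _ => sT S H K nsHG maxK isoS.
exact: hfactors (composition_factor_normal nsHG maxK isoS).
Qed.
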